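(* Let $p\in[1,\infty)$, let $\Delta\subset\mathbb{R}^{4d}$ be measurable with $0<|\Delta|<\infty$, and let $S\in\mathcal{S}^2$. Then the supremum $$\sup_{T\in\mathcal{S}^2\setminus\{0\}}\frac{\left(\int_\Delta|Q_ST(w,z)|^p\,dz\,dw\right)^{1/p}}{\|T\|_{\mathcal{S}^2}}$$ is attained. Furthermore, if $S\neq0$, then any normalized maximizing sequence (that is, a maximizing sequence $(T_n)$ with $\|T_n\|_{\mathcal{S}^2}=1$) has a subsequence converging in $\mathcal{S}^2$ to a maximizer.
   Context: $\mathcal{S}^2$ is the Hilbert space of Hilbert--Schmidt operators on the complex Hilbert space $L^2(\mathbb{R}^d)$, with inner product $\langle T,S\rangle_{\mathcal{S}^2}=\operatorname{tr}(TS^* )$. For $z=(x,\xi)\in\mathbb{R}^{2d}$, $\pi(z)f(y)=e^{2\pi i\xi\cdot y}f(y-x)$. For $S,T\in\mathcal{S}^2$ and $w,z\in\mathbb{R}^{2d}$, the polarized Cohen's class of $T$ with respect to $S$ is $Q_ST(w,z)=\langle T,\pi(z)S\pi(w)^*\rangle_{\mathcal{S}^2}$, a function of $(w,z)\in\mathbb{R}^{4d}$. *)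

(* Defs.v *)
From HB Require Import structures.
From mathcomp Require Import all_boot all_order all_algebra.
From mathcomp Require Import all_classical all_reals all_analysis.
From mathcomp Require Import measurable_realfun complex ring.

Set Implicit Arguments.
Unset Strict Implicit.
Unset Printing Implicit Defensive.
Import Order.TTheory GRing.Theory Num.Theory.
Import numFieldNormedType.Exports ComplexField.Normc.

Local Open Scope classical_set_scope.
Local Open Scope ring_scope.
Local Open Scope complex_scope.

Section ProductMeasure.
Context d1 d2 (T1 : measurableType d1) (T2 : measurableType d2) (R : realType).
Variable m1 : {sigma_finite_measure set T1 -> \bar R}.
Variable m2 : {sigma_finite_measure set T2 -> \bar R}.
Local Open Scope ereal_scope.

(* [m1 \x m2] only has a canonical sigma-finite structure when [m1] and [m2]
   are subprobabilities; this alias has one for sigma-finite factors. *)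
Definition prod_measure : set (T1 * T2) -> \bar R := m1 \x m2.

HB.instance Definition _ := Measure.copy prod_measure (m1 \x m2).

Let prod_measure_sigma_finite : sigma_finite setT prod_measure.
Proof.
have /sigma_finiteP[F [TF ndF Foo]] := sigma_finiteT m1.
have /sigma_finiteP[G [TG ndG Goo]] := sigma_finiteT m2.
exists (fun n => F n `*` G n).
  rewrite -setXTT TF TG predeqE => -[x y]; split.
    move=> [/= [n _ Fnx] [k _ Gky]]; exists (maxn n k) => //; split.
    - by move: x Fnx; exact/subsetPset/ndF/leq_maxl.
    - by move: y Gky; exact/subsetPset/ndG/leq_maxr.
  by move=> [n _ []/= ? ?]; split; exists n.
move=> k; have [? ?] := Foo k; have [? ?] := Goo k.
split; first exact: measurableX.
by rewrite /prod_measure product_measure1E// lte_mul_pinfty// ge0_fin_numE.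
Qed.

HB.instance Definition _ := Measure_isSigmaFinite.Build _ _ _ prod_measure
  prod_measure_sigma_finite.

End ProductMeasure.

Notation euclidean R d := (d.-tuple (measurableTypeR R)).

Section LebesgueStep.
Context {R : realType} (n : nat).
Variable m : {sigma_finite_measure set (euclidean R n) -> \bar R}.
Local Open Scope ereal_scope.

Definition cons_pair (p : measurableTypeR R * euclidean R n) :
  euclidean R n.+1 := [tuple of p.1 :: p.2].

Lemma measurable_cons_pair : measurable_fun [set: _] cons_pair.
Proof. exact: measurable_cons. Qed.

Definition lebesgue_step : set (euclidean R n.+1) -> \bar R :=
  pushforward (prod_measure (@lebesgue_measure R) m) cons_pair.

HB.instance Definition _ := Measure.copy lebesgue_step
  (measure_function_pushforward__canonical__measure_function_Measure
     (prod_measure (@lebesgue_measure R) m) measurable_cons_pair).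

Let lebesgue_step_sigma_finite : sigma_finite setT lebesgue_step.
Proof.
have [F FT Ffin] := sigma_finiteT (prod_measure (@lebesgue_measure R) m).
pose uncons (t : euclidean R n.+1) : measurableTypeR R * euclidean R n :=
  (thead t, [tuple of behead t]).
have munc : measurable_fun [set: _] uncons.
  apply/measurable_fun_pair => /=; last exact: measurable_behead.
  exact: measurable_tnth.
exists (fun k => uncons @^-1` F k).
  by rewrite -preimage_bigcup -FT preimage_setT.
move=> k; have [mF Fk] := Ffin k; split.
  by rewrite -[X in measurable X]setTI; exact: munc.
rewrite /lebesgue_step /pushforward -comp_preimage.
rewrite (_ : uncons \o cons_pair = id) ?preimage_id//.
apply/funext => -[x t] /=; rewrite /uncons /cons_pair /= theadE.
by congr pair; apply/val_inj.
Qed.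

HB.instance Definition _ := Measure_isSigmaFinite.Build _ _ _ lebesgue_step
  lebesgue_step_sigma_finite.

End LebesgueStep.

(* Lebesgue measure on the Borel sets of R^n, as an iterated product *)
Fixpoint lebesgue_rn {R : realType} (n : nat) :
    {sigma_finite_measure set (euclidean R n) -> \bar R} :=
  match n with
  | 0 => \d_([tuple] : euclidean R 0)
  | n'.+1 => lebesgue_step (lebesgue_rn n')
  end.

Section L2.
Context (R : realType) (d : nat).
Local Notation C := (R[i]).
Local Notation E := (euclidean R d).
Local Notation mu := (@lebesgue_rn R d).

Definition sq_integrable : {pred E -> C} := mem [set f : E -> C |
  [/\ measurable_fun setT (fun x => complex.Re (f x)),
      measurable_fun setT (fun x => complex.Im (f x)) &
      (\int[mu]_x ((normc (f x) ^+ 2)%:E) < +oo)%E]].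

Let normc2E (z : C) : normc z ^+ 2 = complex.Re z ^+ 2 + complex.Im z ^+ 2.
Proof. by case: z => a b /=; rewrite sqr_sqrtr// addr_ge0// sqr_ge0. Qed.

Let Re_lin (a z w : C) : complex.Re (a * z + w) =
  (complex.Re a * complex.Re z - complex.Im a * complex.Im z) + complex.Re w.
Proof. by case: a z w => ? ? [? ?] [? ?]. Qed.

Let Im_lin (a z w : C) : complex.Im (a * z + w) =
  (complex.Re a * complex.Im z + complex.Im a * complex.Re z) + complex.Im w.
Proof. by case: a z w => ? ? [? ?] [? ?]. Qed.

Let measurable_normc2 (f : E -> C) :
  measurable_fun setT (fun x => complex.Re (f x)) ->
  measurable_fun setT (fun x => complex.Im (f x)) ->
  measurable_fun setT (fun x => (normc (f x) ^+ 2)%:E : \bar R).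
Proof.
move=> mr mi; apply/measurable_EFinP.
under eq_fun do rewrite normc2E.
by apply: measurable_funD; exact: measurable_funX.
Qed.

Lemma sq_integrable_submod_closed : submod_closed sq_integrable.
Proof.
split=> [|a f g]; rewrite !inE.
  split; [exact: measurable_cst..|].
  rewrite integral0_eq// => x _.
  by rewrite normc0 expr0n.
move=> [mfr mfi ff] [mgr mgi gf].
have mr : measurable_fun setT (fun x => complex.Re ((a *: f + g) x)).
  rewrite (_ : (fun x => _) = (fun x => (complex.Re a * complex.Re (f x) -
      complex.Im a * complex.Im (f x)) + complex.Re (g x))); last first.
    by apply/funext => x; exact: Re_lin.
  apply: measurable_funD => //; apply: measurable_funB; exact: measurable_funM.
have mi : measurable_fun setT (fun x => complex.Im ((a *: f + g) x)).
  rewrite (_ : (fun x => _) = (fun x => (complex.Re a * complex.Im (f x) +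
      complex.Im a * complex.Re (f x)) + complex.Im (g x))); last first.
    by apply/funext => x; exact: Im_lin.
  apply: measurable_funD => //; apply: measurable_funD; exact: measurable_funM.
split=> //.
apply: (@le_lt_trans _ _ (\int[mu]_x ((2 * normc a ^+ 2)%:E * (normc (f x) ^+ 2)%:E
   + 2%:E * (normc (g x) ^+ 2)%:E))%E).
  apply: ge0_le_integral => //.
  - by move=> x _; rewrite lee_fin sqr_ge0.
  - exact: measurable_normc2.
  - by apply: emeasurable_funD; apply: measurable_funeM; exact: measurable_normc2.
  - move=> x _; rewrite -!EFinM -EFinD lee_fin !fctE !normc2E.
    case: a (f x) (g x) {mr mi} => a b [u v] [s t] /=.
    set p := a * u - b * v; set q := a * v + b * u.
    have -> : 2 * (a ^+ 2 + b ^+ 2) * (u ^+ 2 + v ^+ 2) = 2 * (p ^+ 2 + q ^+ 2).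
      by rewrite /p /q; ring.
    rewrite -subr_ge0 (_ : _ - _ = (p - s) ^+ 2 + (q - t) ^+ 2); last by ring.
    by rewrite addr_ge0// sqr_ge0.
have n0 (h : E -> C) x : (0 <= (normc (h x) ^+ 2)%:E)%E.
  by rewrite lee_fin sqr_ge0.
have a0 : 0 <= 2 * normc a ^+ 2 by rewrite mulr_ge0// sqr_ge0.
have mf := measurable_normc2 mfr mfi.
have mg := measurable_normc2 mgr mgi.
rewrite ge0_integralD//.
- rewrite !ge0_integralZl//.
  by rewrite lte_add_pinfty// lte_mul_pinfty// lee_fin.
- by move=> x _; rewrite mule_ge0// lee_fin.
- exact: measurable_funeM.
- by move=> x _; rewrite mule_ge0// lee_fin.
- exact: measurable_funeM.
Qed.

HB.instance Definition _ := GRing.isSubmodClosed.Build _ _ sq_integrable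
  sq_integrable_submod_closed.

Record L2fun := MkL2fun {L2fun_val :> E -> C; _ : L2fun_val \in sq_integrable}.

HB.instance Definition _ := [isSub for L2fun_val].
HB.instance Definition _ := gen_eqMixin L2fun.
HB.instance Definition _ := gen_choiceMixin L2fun.
HB.instance Definition _ := [SubChoice_isSubLmodule of L2fun by <:].

Definition ae_equal (f g : L2fun) : bool := `[< {ae mu, forall x, f x = g x} >].

Let ae_equal_refl : reflexive ae_equal.
Proof. by move=> f; apply/asboolP/nearW. Qed.

Let ae_equal_sym : symmetric ae_equal.
Proof.
by move=> f g; apply/asboolP/asboolP; apply: filterS => x ->.
Qed.

Let ae_equal_trans : transitive ae_equal.
Proof.
move=> f g h /asboolP gf /asboolP fh; apply/asboolP.
by apply: filterS2 gf fh => x -> ->.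
Qed.

Canonical ae_equal_equiv :=
  EquivRel ae_equal ae_equal_refl ae_equal_sym ae_equal_trans.

Local Open Scope quotient_scope.

(* Borel representatives suffice: every Lebesgue measurable function is almost
   everywhere equal to a Borel one. *)
Definition L2 : Type := {eq_quot ae_equal}.
HB.instance Definition _ := Choice.on L2.
HB.instance Definition _ := EqQuotient.on L2.

Let ae_repr (f : L2fun) : {ae mu, forall x, repr (\pi_L2 f) x = f x}.
Proof. by have /eqP := reprK (\pi_L2 f); rewrite eqmodE => /asboolP. Qed.

Let L2_eqP (f g : L2fun) :
  {ae mu, forall x, f x = g x} -> \pi_L2 f = \pi_L2 g.
Proof. by move=> fg; apply/eqP; rewrite eqmodE; apply/asboolP. Qed.

Definition L2_add (f g : L2) : L2 := \pi_L2 (repr f + repr g).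
Definition L2_opp (f : L2) : L2 := \pi_L2 (- repr f).
Definition L2_scale (a : C) (f : L2) : L2 := \pi_L2 (a *: repr f).

Let pi_add (f g : L2fun) : L2_add (\pi f) (\pi g) = \pi_L2 (f + g).
Proof.
apply: L2_eqP; apply: filterS2 (ae_repr f) (ae_repr g) => x fx gx.
by rewrite /= !fctE fx gx.
Qed.

Let pi_opp (f : L2fun) : L2_opp (\pi f) = \pi_L2 (- f).
Proof. by apply: L2_eqP; apply: filterS (ae_repr f) => x fx; rewrite /= !fctE fx. Qed.

Let pi_scale a (f : L2fun) : L2_scale a (\pi f) = \pi_L2 (a *: f).
Proof. by apply: L2_eqP; apply: filterS (ae_repr f) => x fx; rewrite /= !fctE fx. Qed.

Let L2_addA : associative L2_add.
Proof.
by move=> f g h; rewrite -[f]reprK -[g]reprK -[h]reprK !pi_add addrA.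
Qed.

Let L2_addC : commutative L2_add.
Proof. by move=> f g; rewrite -[f]reprK -[g]reprK !pi_add addrC. Qed.

Let L2_add0 : left_id (\pi_L2 0) L2_add.
Proof. by move=> f; rewrite -[f]reprK !pi_add add0r. Qed.

Let L2_addN : left_inverse (\pi_L2 0) L2_opp L2_add.
Proof. by move=> f; rewrite -[f]reprK pi_opp !pi_add addNr. Qed.

HB.instance Definition _ := GRing.isZmodule.Build L2
  L2_addA L2_addC L2_add0 L2_addN.

Let L2_scaleA a b (f : L2) : L2_scale a (L2_scale b f) = L2_scale (a * b) f.
Proof. by rewrite -[f]reprK !pi_scale scalerA. Qed.

Let L2_scale1 : left_id 1 L2_scale.
Proof. by move=> f; rewrite -[f]reprK !pi_scale scale1r. Qed.

Let L2_scaleDr : right_distributive L2_scale +%R.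
Proof.
move=> a f g; rewrite -[f]reprK -[g]reprK.
by rewrite [X in L2_scale a X]pi_add !pi_scale [RHS]pi_add scalerDr.
Qed.

Let L2_scaleDl f : {morph L2_scale^~ f : a b / a + b}.
Proof. by move=> a b; rewrite -[f]reprK !pi_scale [RHS]pi_add scalerDl. Qed.

HB.instance Definition _ := GRing.Zmodule_isLmodule.Build C L2
  L2_scaleA L2_scale1 L2_scaleDr L2_scaleDl.

End L2.

Section HilbertSchmidt.
Context (R : realType) (d : nat).
Local Notation C := (R[i]).
Local Notation E := (euclidean R d).
Local Notation mu := (@lebesgue_rn R d).
Local Notation H := (L2 R d).

(* Real and imaginary parts are taken separately below, for integrals and for
   limits, since [R[i]] carries no measurable or topological structure. *)
Definition L2_dot (f g : H) : C :=
  let h x := repr f x * (repr g x)^*%C in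
  (\int[mu]_x complex.Re (h x))%R +i* (\int[mu]_x complex.Im (h x))%R.

Definition L2_norm (f : H) : R := Num.sqrt (complex.Re (L2_dot f f)).

Definition bounded_op (A : H -> H) : Prop :=
  exists M : R, forall f, L2_norm (A f) <= M * L2_norm f.

Definition adjoint (A : H -> H) : H -> H :=
  xget (fun=> 0) [set B : H -> H | forall f g, L2_dot (A f) g = L2_dot f (B g)].

Definition orthonormal_basis (e : nat -> H) : Prop :=
  (forall i j, L2_dot (e i) (e j) = (i == j)%:R) /\
  (forall f, (forall k, L2_dot f (e k) = 0) -> f = 0).

(* One fixed orthonormal basis; the Hilbert-Schmidt condition and the trace do
   not depend on which one. *)
Definition L2_basis : nat -> H := xget (fun=> 0) [set e | orthonormal_basis e].

Definition trace (A : H -> H) : C :=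
  let t k := L2_dot (A (L2_basis k)) (L2_basis k) in
  limn (series (fun k => complex.Re (t k))) +i*
  limn (series (fun k => complex.Im (t k))).

Definition hilbert_schmidt : set (H -> H) := [set T | [/\ linear T, bounded_op T &
  (\sum_(0 <= k <oo) (L2_norm (T (L2_basis k)) ^+ 2)%:E < +oo)%E]].

Definition HS_dot (T S : H -> H) : C := trace (T \o adjoint S).

Definition HS_norm (T : H -> H) : R := Num.sqrt (complex.Re (HS_dot T T)).

(* The class of [g]; the zero class if [g] is not square integrable. *)
Definition L2_class (g : E -> C) : H :=
  (\pi_(H) (insubd (0 : L2fun R d) g))%qT.

Definition euclid_sub (y x : E) : E :=
  [tuple (tnth y i : R) - (tnth x i : R) | i < d].

Definition euclid_dot (x y : E) : R := \sum_(i < d) (tnth x i : R) * tnth y i.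

Definition cexpi (t : R) : C := cos t +i* sin t.

(* The argument of [L2_class] is always square integrable, by translation
   invariance of [lebesgue_rn]. *)
Definition tf_shift (z : E * E) (f : H) : H :=
  L2_class (fun y => cexpi (2 * pi * euclid_dot z.2 y) *
                     repr f (euclid_sub y z.1)).

(* Polarized Cohen's class of [T] with respect to [S], at [wz = (w, z)] *)
Definition cohen (S T : H -> H) (wz : (E * E) * (E * E)) : C :=
  HS_dot T (tf_shift wz.2 \o S \o adjoint (tf_shift wz.1)).

End HilbertSchmidt.

Section Concentration.
Context (R : realType) (d : nat).
Local Notation E := (euclidean R d).
Local Notation H := (L2 R d).

Definition phase_measure : {sigma_finite_measure set (E * E)%type -> \bar R} :=
  prod_measure (@lebesgue_rn R d) (@lebesgue_rn R d).

Definition borel_lebesgue4 :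
    {sigma_finite_measure set ((E * E) * (E * E))%type -> \bar R} :=
  prod_measure phase_measure phase_measure.

(* R^{4d} with its sigma-algebra of Lebesgue (not just Borel) measurable sets *)
Definition double_phase : measurableType _ :=
  caratheodory_type (mu_ext borel_lebesgue4).

Definition lebesgue4 : {measure set double_phase -> \bar R} :=
  @completed_measure_extension _ _ _ borel_lebesgue4.

Definition concentration (p : R) (Delta : set double_phase) (S T : H -> H) :
    \bar R :=
  ((\int[lebesgue4]_(wz in Delta) (normc (cohen S T wz) `^ p)%:E) `^ p^-1 *
   ((HS_norm T)^-1)%:E)%E.

Definition max_concentration p Delta S : \bar R :=
  ereal_sup [set concentration p Delta S T | T in
              [set T | hilbert_schmidt T /\ T <> (fun=> 0)]].

Definition maximizer p Delta S (T : H -> H) : Prop :=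
  [/\ hilbert_schmidt T, T <> (fun=> 0) &
      concentration p Delta S T = max_concentration p Delta S].

End Concentration.

(* Main.v *)
(* The operator T |-> Q_S T restricted to Delta is compact from S^2 to L^p(Delta).
   Fix an orthonormal basis e. The map T |-> (T^* e_k)_k identifies S^2 with
   l^2(N; L^2), and Q_S T(w,z) = <T, pi(z) S pi(w)^*> is for fixed (w,z) a bounded
   linear functional of norm at most |S|. Hence, if T_n converges weakly to T with
   |T_n| <= 1, then Q_S T_n -> Q_S T pointwise and boundedly, and dominated
   convergence on the finite measure set Delta gives convergence of the p-th power
   integrals. A normalized maximizing sequence has a weak limit T along a
   subsequence, with |T| <= 1, whose numerator is the supremum M. When S <> 0 we have
   M > 0: otherwise, at some (w,z) in Delta, pi(z) S pi(w)^* would be orthogonal to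
   all the rank-one operators built on e, hence zero, while its norm is |S|. So
   T <> 0, and M / |T| <= M forces |T| = 1; weak convergence together with convergence
   of the norms is strong convergence. *)
Require Import Defs.
From HB Require Import structures.
From mathcomp Require Import all_boot all_order all_algebra.
From mathcomp Require Import all_classical all_reals all_analysis.
From mathcomp Require Import measurable_realfun complex ring lra.
Set Implicit Arguments.
Unset Strict Implicit.
Unset Printing Implicit Defensive.
Import Order.TTheory GRing.Theory Num.Theory.
Import numFieldNormedType.Exports ComplexField.Normc.
Local Open Scope classical_set_scope.
Local Open Scope ring_scope.
Local Open Scope complex_scope.
(** * The Hilbert space L2 *)

Section SquareIntegrable.
Context (R : realType) (d : nat).
Local Notation C := (R[i]).
Local Notation E := (euclidean R d).
Local Notation mu := (@lebesgue_rn R d).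
Local Notation H := (L2 R d).
Local Notation sqi := (@sq_integrable R d).
Implicit Types (f g h : E -> C) (u v : E -> R) (a : C).

(** Weak compactness of the unit ball of S^2 is built by hand. An operator is determined by the
    numbers <e_j, T^* e_k>; Tychonoff's theorem and a diagonal choice make all of them converge
    along one subsequence, Bessel's inequality bounds the squares of the limits, and the
    Riesz-Fischer theorem, which rests on the completeness of L2, turns the limits back into an
    operator. The vectors T^* e_k are used instead of T e_k because the trace of T A^* is the sum of
    the <A^* e_k, T^* e_k>, an inner product in l^2(N; L2).

    Dominated convergence requires Q_S T to be measurable, while [repr] and [adjoint] are chosen
    anew at each point (w, z). So Q_S T is written with limits of finite sums in which only numbers
    <pi(z) f, g> depend on the point, and these are parametric integrals of an explicit, jointly
    measurable function. The adjoint of pi(z) is never computed: that pi(z) is a linear isometry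
    suffices.

    [L2_basis] is chosen as well; that it is an orthonormal basis is a hypothesis of the later
    sections, discharged at the very end. *)

Lemma Re_mul_conj (z w : C) : complex.Re (z * w^*%C) =
  complex.Re z * complex.Re w + complex.Im z * complex.Im w.
Proof. by case: z w => ? ? [? ?] /=; ring. Qed.

Lemma Im_mul_conj (z w : C) : complex.Im (z * w^*%C) =
  complex.Im z * complex.Re w - complex.Re z * complex.Im w.
Proof. by case: z w => ? ? [? ?] /=; ring. Qed.

Lemma normc2E (z : C) : normc z ^+ 2 = complex.Re z ^+ 2 + complex.Im z ^+ 2.
Proof. by case: z => a b /=; rewrite sqr_sqrtr// addr_ge0// sqr_ge0. Qed.

Lemma normc_ge0 (z : C) : 0 <= normc z.
Proof. by case: z => a b /=; rewrite sqrtr_ge0. Qed.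

Lemma sq_integrableP f : f \in sqi <->
  [/\ measurable_fun setT (fun x => complex.Re (f x)),
      measurable_fun setT (fun x => complex.Im (f x)) &
      (\int[mu]_x ((normc (f x) ^+ 2)%:E) < +oo)%E].
Proof. by rewrite /sq_integrable !inE. Qed.

(** The product is dominated by [u x ^+ 2 + v x ^+ 2]. *)
Lemma integrable_mul u v :
  measurable_fun setT u -> measurable_fun setT v ->
  mu.-integrable setT (fun x => (u x ^+ 2)%:E) ->
  mu.-integrable setT (fun x => (v x ^+ 2)%:E) ->
  mu.-integrable setT (fun x => (u x * v x)%:E).
Proof.
move=> mf mg f2 g2.
apply: (le_integrable measurableT _ _ (integrableD measurableT f2 g2)).
  by apply/measurable_EFinP; exact: measurable_funM.
move=> x _ /=; rewrite lee_fin normrM.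
rewrite (@ger0_norm _ (u x ^+ 2 + _)) ?addr_ge0 ?sqr_ge0//.
rewrite -(real_normK (num_real (u x))) -(real_normK (num_real (v x))).
have := sqr_ge0 (`|u x| - `|v x|); have := sqr_ge0 (`|u x| + `|v x|).
nra.
Qed.

Lemma sq_integrable_Re f : f \in sqi ->
  mu.-integrable setT (fun x => (complex.Re (f x) ^+ 2)%:E).
Proof.
move=> /sq_integrableP[mr mi fi]; apply/integrableP; split.
  by apply/measurable_EFinP; exact: measurable_funX.
apply: le_lt_trans fi; apply: ge0_le_integral => //.
- by do 2!apply: measurableT_comp => //; exact: measurable_funX.
- apply/measurable_EFinP; under eq_fun do rewrite normc2E.
  by apply: measurable_funD; exact: measurable_funX.
- move=> x _; rewrite abse_EFin lee_fin ger0_norm ?sqr_ge0// normc2E.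
  by rewrite lerDl sqr_ge0.
Qed.

Lemma sq_integrable_Im f : f \in sqi ->
  mu.-integrable setT (fun x => (complex.Im (f x) ^+ 2)%:E).
Proof.
move=> /sq_integrableP[mr mi fi]; apply/integrableP; split.
  by apply/measurable_EFinP; exact: measurable_funX.
apply: le_lt_trans fi; apply: ge0_le_integral => //.
- by do 2!apply: measurableT_comp => //; exact: measurable_funX.
- apply/measurable_EFinP; under eq_fun do rewrite normc2E.
  by apply: measurable_funD; exact: measurable_funX.
- move=> x _; rewrite abse_EFin lee_fin ger0_norm ?sqr_ge0// normc2E.
  by rewrite lerDr sqr_ge0.
Qed.

Lemma integrable_Re_dot f g : f \in sqi -> g \in sqi ->
  mu.-integrable setT (fun x => (complex.Re (f x * (g x)^*%C))%:E).
Proof.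
move=> fi gi; under eq_fun do rewrite Re_mul_conj.
have /sq_integrableP[fr fm _] := fi; have /sq_integrableP[gr gm _] := gi.
under eq_fun do rewrite EFinD.
apply: integrableD => //; apply: integrable_mul => //.
- exact: sq_integrable_Re.
- exact: sq_integrable_Re.
- exact: sq_integrable_Im.
- exact: sq_integrable_Im.
Qed.

Lemma integrable_Im_dot f g : f \in sqi -> g \in sqi ->
  mu.-integrable setT (fun x => (complex.Im (f x * (g x)^*%C))%:E).
Proof.
move=> fi gi; under eq_fun do rewrite Im_mul_conj.
have /sq_integrableP[fr fm _] := fi; have /sq_integrableP[gr gm _] := gi.
under eq_fun do rewrite EFinB.
apply: integrableB => //; apply: integrable_mul => //.
- exact: sq_integrable_Im.
- exact: sq_integrable_Re.
- exact: sq_integrable_Re.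
- exact: sq_integrable_Im.
Qed.

(** [L2_dot f g] is [fun_dot (repr f) (repr g)] by conversion; on functions, [fun_dot_ae] allows one
    representative to be exchanged for another. *)
Definition fun_dot f g : C :=
  (\int[mu]_x complex.Re (f x * (g x)^*%C))%R +i*
  (\int[mu]_x complex.Im (f x * (g x)^*%C))%R.

Lemma Re_lin (a z w : C) : complex.Re (a * z + w) =
  (complex.Re a * complex.Re z - complex.Im a * complex.Im z) + complex.Re w.
Proof. by case: a z w => ? ? [? ?] [? ?]. Qed.

Lemma Im_lin (a z w : C) : complex.Im (a * z + w) =
  (complex.Re a * complex.Im z + complex.Im a * complex.Re z) + complex.Im w.
Proof. by case: a z w => ? ? [? ?] [? ?]. Qed.

Lemma fun_dot_lin a f g h : f \in sqi -> g \in sqi -> h \in sqi ->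
  fun_dot (a *: f + g) h = a * fun_dot f h + fun_dot g h.
Proof.
move=> fi gi hi; rewrite /fun_dot.
have Rf := integrable_Re_dot fi hi; have If := integrable_Im_dot fi hi.
have Rg := integrable_Re_dot gi hi; have Ig := integrable_Im_dot gi hi.
have cR r F : mu.-integrable setT (fun x => (F x)%:E) ->
    mu.-integrable setT (fun x => (r * F x)%:E).
  by move=> iF; under eq_fun do rewrite EFinM; exact: integrableZl.
apply/eqP; rewrite eq_complex Re_lin Im_lin /=; apply/andP; split; apply/eqP.
- rewrite -!RintegralZl// -RintegralB//; [|exact: cR..].
  rewrite -RintegralD//=; last first.
    rewrite /comp; under eq_fun do rewrite EFinB.
    by apply: integrableB => //; exact: cR.
  apply: eq_Rintegral => x _; rewrite !fctE.
  by case: a (f x) (g x) (h x) => ? ? [? ?] [? ?] [? ?] /=; ring.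
- rewrite -!RintegralZl// -RintegralD//; [|exact: cR..].
  rewrite -RintegralD//=; last first.
    rewrite /comp; under eq_fun do rewrite EFinD.
    by apply: integrableD => //; exact: cR.
  apply: eq_Rintegral => x _; rewrite !fctE.
  by case: a (f x) (g x) (h x) => ? ? [? ?] [? ?] [? ?] /=; ring.
Qed.

Lemma fun_dot_conj f g : f \in sqi -> g \in sqi ->
  fun_dot g f = (fun_dot f g)^*%C.
Proof.
move=> fi gi; rewrite /fun_dot /=; congr Complex.
  by apply: eq_Rintegral => x _; rewrite !Re_mul_conj; ring.
rewrite -[RHS]mulN1r -RintegralZl//; last exact: integrable_Im_dot.
by apply: eq_Rintegral => x _; rewrite !Im_mul_conj; ring.
Qed.

Lemma fun_dot_ae f f' g g' : f \in sqi -> f' \in sqi -> g \in sqi -> g' \in sqi ->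
  {ae mu, forall x, f x = f' x} -> {ae mu, forall x, g x = g' x} ->
  fun_dot f g = fun_dot f' g'.
Proof.
move=> fi fi' gi gi' ff' gg'; rewrite /fun_dot; congr Complex; congr fine;
  apply: ae_eq_integral => //.
- by have /integrableP[] := integrable_Re_dot fi gi.
- by have /integrableP[] := integrable_Re_dot fi' gi'.
- by apply: filterS2 ff' gg' => x -> ->.
- by have /integrableP[] := integrable_Im_dot fi gi.
- by have /integrableP[] := integrable_Im_dot fi' gi'.
- by apply: filterS2 ff' gg' => x -> ->.
Qed.

Lemma measurable_normc2 f : f \in sqi ->
  measurable_fun setT (fun x => (normc (f x) ^+ 2)%:E).
Proof.
move=> /sq_integrableP[mr mi _]; apply/measurable_EFinP.
under eq_fun do rewrite normc2E.
by apply: measurable_funD; exact: measurable_funX.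
Qed.

Lemma fun_dot_self f : f \in sqi ->
  (complex.Re (fun_dot f f))%:E = (\int[mu]_x (normc (f x) ^+ 2)%:E)%E.
Proof.
move=> fi; rewrite /fun_dot /= /Rintegral.
under eq_integral do rewrite Re_mul_conj -!expr2 -normc2E.
have /sq_integrableP[_ _ foo] := fi.
by rewrite fineK// ge0_fin_numE// integral_ge0// => x _; rewrite lee_fin sqr_ge0.
Qed.

Lemma mem_repr (f : H) : L2fun_val (repr f) \in sqi.
Proof. exact: (valP (repr f)). Qed.

Lemma ae_repr (f : L2fun R d) :
  {ae mu, forall x, repr (\pi_(H)%qT f) x = f x}.
Proof.
have /eqP : \pi_(H)%qT (repr (\pi_(H)%qT f)) = \pi_(H)%qT f by rewrite reprK.
by rewrite eqmodE => /asboolP.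
Qed.

Lemma L2_dot_lin a (f g h : H) :
  L2_dot (a *: f + g) h = a * L2_dot f h + L2_dot g h.
Proof.
rewrite -[L2_dot f h]/(fun_dot _ _) -[L2_dot g h]/(fun_dot _ _).
rewrite -fun_dot_lin; [|exact: mem_repr..].
apply: fun_dot_ae; [exact: mem_repr| |exact: mem_repr|exact: mem_repr| |].
- apply: (valP (a *: repr f + repr g)).
(* Scaling and addition each return to the quotient, so a representative is chosen twice. *)
- have h1 := ae_repr (a *: repr f).
  have h2 := ae_repr (repr (L2_scale a f) + repr g).
  apply: filterS2 h1 h2 => x h1 h2.
  by rewrite [LHS]h2 /= !fctE; congr (_ + _).
- exact: nearW.
Qed.

Lemma L2_dot_conj (f g : H) : L2_dot g f = (L2_dot f g)^*%C.
Proof. by apply: fun_dot_conj; exact: mem_repr. Qed.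

Lemma L2_dot_ge0 (f : H) : 0 <= complex.Re (L2_dot f f).
Proof.
rewrite -lee_fin fun_dot_self ?mem_repr// integral_ge0// => x _.
by rewrite lee_fin sqr_ge0.
Qed.

Lemma eq_L2 (f g : H) : {ae mu, forall x, repr f x = repr g x} -> f = g.
Proof.
move=> fg; rewrite -[f]reprK -[g]reprK; apply/eqP; rewrite eqmodE.
exact/asboolP.
Qed.

Lemma L2_dot_eq0 (f : H) : complex.Re (L2_dot f f) = 0 -> f = 0.
Proof.
move=> f0; have := fun_dot_self (mem_repr f); rewrite [fun_dot _ _]/(L2_dot _ _) f0.
have pos x : (`|(normc (repr f x) ^+ 2)%:E| = (normc (repr f x) ^+ 2)%:E)%E.
  by rewrite gee0_abs// lee_fin sqr_ge0.
have m2 := measurable_normc2 (mem_repr f).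
move=> /esym i0; apply: eq_L2.
have : (\int[mu]_x `|(normc (repr f x) ^+ 2)%:E| = 0)%E.
  by under eq_integral do rewrite pos.
move=> /(ae_eq_integral_abs mu measurableT m2).
have -> : (0 : H) = \pi_(H)%qT 0 by [].
move=> h1; have h2 := ae_repr 0.
apply: filterS2 h1 h2 => x /(_ I) /= + ->.
by move=> [] /eqP; rewrite sqrf_eq0 => /eqP/eq0_normc.
Qed.
End SquareIntegrable.

(** * Completeness of L2 *)

Section L2Complete.
Context (R : realType) (d : nat).
Local Notation C := (R[i]).
Local Notation E := (euclidean R d).
Local Notation mu := (@lebesgue_rn R d).
Local Notation H := (L2 R d).
Local Notation sqi := (@sq_integrable R d).

Lemma L2_norm_sqr (f : H) : L2_norm f ^+ 2 = complex.Re (L2_dot f f).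
Proof. by rewrite /L2_norm sqr_sqrtr// L2_dot_ge0. Qed.

Lemma repr_lin (a : C) (f g : H) :
  {ae mu, forall x, repr (a *: f + g) x = a * repr f x + repr g x}.
Proof.
have h1 := ae_repr (a *: repr f).
have h2 := ae_repr (repr (L2_scale a f) + repr g).
apply: filterS2 h1 h2 => x h1 h2.
by rewrite [LHS]h2 /= !fctE; congr (_ + _).
Qed.

Lemma repr_sub (f g : H) :
  {ae mu, forall x, repr (f - g) x = repr f x - repr g x}.
Proof.
have := repr_lin (- 1) g f; apply: filterS => x.
rewrite scaleN1r mulN1r => h; by rewrite addrC h addrC.
Qed.

Lemma L2_norm_ae (f : H) (F : E -> C) : F \in sqi ->
  {ae mu, forall x, repr f x = F x} ->
  (L2_norm f ^+ 2)%:E = (\int[mu]_x (normc (F x) ^+ 2)%:E)%E.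
Proof.
move=> Fi fF; rewrite L2_norm_sqr -fun_dot_self//; congr (_%:E).
by congr complex.Re; apply: fun_dot_ae => //; exact: mem_repr.
Qed.

Lemma limn_einf_le (u : (\bar R)^nat) (c : \bar R) (K : nat) :
  (forall k, (K <= k)%N -> (u k <= c)%E) -> (limn_einf u <= c)%E.
Proof.
move=> uc; rewrite limn_einf_lim (cvg_lim _ (@cvg_einfs_sup _ u))//.
apply: ge_ereal_sup => _ [n _ <-]; apply: (@le_trans _ _ (u (maxn n K))).
  by apply: ereal_inf_lbound; exists (maxn n K) => //=; rewrite leq_maxl.
by apply: uc; rewrite leq_maxr.
Qed.

Lemma is_cvg_series_bounded (u : R^nat) (M : R) : (forall k, 0 <= u k) ->
  (forall n, series u n <= M) -> cvgn (series u).
Proof.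
move=> u0 uM; apply: nondecreasing_is_cvgn.
  exact: nondecreasing_series.
by exists M => _ [n _ <-].
Qed.

(** The weighted squares dominate the increments up to the summable error 2^-k, so the telescoping
    series converges absolutely. Squares are used because their integrals are L2 norms. *)
Lemma is_cvg_sum_weighted (u : R^nat) (M : R) :
  (forall n, \sum_(k < n) 2 ^+ k * (u k.+1 - u k) ^+ 2 <= M) -> cvgn u.
Proof.
move=> uM.
have : cvgn (series (telescope u)).
  apply: normed_cvg.
  apply: (@is_cvg_series_bounded _ (M + 2)) => [k|n]; first exact: normr_ge0.
  apply: (@le_trans _ _ (\sum_(k < n) (2 ^+ k * (u k.+1 - u k) ^+ 2 + (2 ^+ k)^-1))).
    rewrite /series/= big_mkord; apply: ler_sum => k _.
    set r := telescope u k.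
    have p : (0 : R) < 2 ^+ k by rewrite exprn_gt0.
    have q : 2 ^+ k * (2 ^+ k)^-1 = 1 :> R by rewrite divff ?gt_eqF.
    have q0 : 0 < (2 ^+ k)^-1 :> R by rewrite invr_gt0.
    (* AM-GM: [2 |r| <= 2^k r^2 + 2^-k] *)
    rewrite -(real_normK (num_real (_ - _))) -[_ - _]/r.
    have s0 := normr_ge0 r.
    have := sqr_ge0 (2 ^+ k * `|r| - 1).
    move: (2 ^+ k) ((2 ^+ k)^-1) (`|r|) p q q0 s0 => a b s p q q0 s0 h.
    have : 0 <= b * (a * s - 1) ^+ 2 by rewrite mulr_ge0// ltW.
    have -> : b * (a * s - 1) ^+ 2 = (a * b) * a * s ^+ 2 - 2 * (a * b) * s + b by ring.
    rewrite q; nra.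
  rewrite big_split/=; apply: lerD; first exact: uM.
  have -> : \sum_(i < n) (2 ^+ i)^-1 = 2 - 2 * (2 ^+ n)^-1 :> R.
    elim: n => [|n IH]; first by rewrite big_ord0 expr0 invr1; ring.
    by rewrite big_ord_recr/= IH exprS; field; rewrite expf_neq0.
  by rewrite gerBl mulr_ge0// invr_ge0 exprn_ge0.
move=> /cvg_ex[l ul]; apply/cvg_ex; exists (u 0%N + l).
have hu : u = cst (u 0%N) \+ series (telescope u).
  by apply/funext => n; exact: eq_sum_telescope.
by rewrite {1}hu; apply: cvgD ul; exact: cvg_cst.
Qed.


Lemma L2_norm_ge0 (f : H) : 0 <= L2_norm f.
Proof. exact: sqrtr_ge0. Qed.

(** Along a fast subsequence the representatives converge almost everywhere; Fatou's lemma then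
    carries the Cauchy estimate over to the limit function. *)
Lemma L2_complete (u : nat -> H) :
  (forall e, 0 < e -> exists N, forall m n, (N <= m)%N -> (N <= n)%N ->
    L2_norm (u m - u n) <= e) ->
  exists l, L2_norm (u n - l) @[n --> \oo] --> (0 : R).
Proof.
move=> uC.
have /choice[N NP] (k : nat) : exists N, forall m n, (N <= m)%N -> (N <= n)%N ->
    L2_norm (u m - u n) <= (2 ^+ k.+1)^-1.
  by apply: uC; rewrite invr_gt0 exprn_gt0.
(* The sum makes [M k] at least every [N j] with j <= k; the extra k makes [M] unbounded. *)
pose M k := (\sum_(j < k.+1) N j + k)%N.
have NM k j : (j <= k)%N -> (N j <= M k)%N.
  by move=> jk; rewrite /M (bigD1 (Ordinal (jk : (j < k.+1)%N)))//= -!addnA leq_addr.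
pose v k : E -> C := repr (u (M k)).
have vi k : v k \in sqi by exact: mem_repr.
have Bi f g : f \in sqi -> g \in sqi -> (fun x => f x - g x) \in sqi.
  by move=> fi gi; exact: (rpredB fi gi).
have ae_sub m n : {ae mu, forall x,
    repr (u m - u n) x = repr (u m) x - repr (u n) x} by exact: repr_sub.
(* Along the fast subsequence [M] the weighted sum of the [D k] is integrable, so
   the representatives converge almost everywhere. *)
pose D k x : R := 2 ^+ k * normc (v k.+1 x - v k x) ^+ 2.
have p2 k : 0 < 2 ^+ k :> R by rewrite exprn_gt0.
have D0 k x : 0 <= D k x by rewrite mulr_ge0 ?sqr_ge0// ltW.
have mD k : measurable_fun setT (fun x => (D k x)%:E).
  rewrite /D; under eq_fun do rewrite EFinM.
  by apply: measurable_funeM; apply: measurable_normc2; exact: Bi.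
have ID : (\int[mu]_x (\sum_(k <oo) (D k x)%:E) <= 1%:E)%E.
  rewrite integral_nneseries//; last by move=> k x _; rewrite lee_fin.
  (* The k-th integral is at most 2^k 4^-(k+1), hence at most 2^-(k+1), and these bounds add up to
     1. *)
  apply: le_trans (@epsilon_trick0 R 1 xpredT ler01).
  apply: lee_nneseries => [k _ _|k _]; first by apply: integral_ge0 => x _; rewrite lee_fin.
  rewrite /D; under eq_integral do rewrite EFinM.
  rewrite ge0_integralZl//; last 2 first.
    - by apply: measurable_normc2; exact: Bi.
    - by move=> x _; rewrite lee_fin sqr_ge0.
  rewrite -(@L2_norm_ae (u (M k.+1) - u (M k)))//; last exact: Bi.
  rewrite -EFinM lee_fin div1r.
  have /(_ (M k.+1) (M k)) := NP k.
  rewrite !NM// => /(_ isT isT) h.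
  have n0 := L2_norm_ge0 (u (M k.+1) - u (M k)).
  apply: (@le_trans _ _ (2 ^+ k * ((2 ^+ k.+1)^-1) ^+ 2)).
    by rewrite ler_pM2l//; apply: lerXn2r => //; rewrite nnegrE ?invr_ge0 ?exprn_ge0.
  rewrite natrX expr2 mulrA; apply: ler_piMl; first by rewrite invr_ge0 ltW.
  rewrite exprS invfM mulrCA divff ?gt_eqF// mulr1.
  by rewrite invf_le1 ?ler1n.
have : {ae mu, forall x, setT x -> (\sum_(k <oo) (D k x)%:E)%E \is a fin_num}.
  apply: integrable_ae => //; apply/integrableP; split.
    by apply: ge0_emeasurable_sum => // k x _ _; rewrite lee_fin.
  have S0 x : (0 <= \sum_(k <oo) (D k x)%:E)%E.
    by apply: nneseries_ge0 => k _ _; rewrite lee_fin.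
  by under eq_integral do rewrite gee0_abs//; apply: le_lt_trans ID _; rewrite ltry.
move=> good.
have cvgRe x : (\sum_(k <oo) (D k x)%:E)%E \is a fin_num ->
    cvgn (fun k => complex.Re (v k x)) /\ cvgn (fun k => complex.Im (v k x)).
  move=> fx.
  have bnd n : \sum_(k < n) D k x <= fine (\sum_(k <oo) (D k x)%:E)%E.
    rewrite -lee_fin fineK// -sumEFin.
    apply: le_trans (@nneseries_lim_ge _ (fun k => (D k x)%:E) xpredT 0 n _).
      by rewrite big_mkord.
    by move=> k _ _; rewrite lee_fin.
  split; apply: (@is_cvg_sum_weighted _ (fine (\sum_(k <oo) (D k x)%:E)%E)) => n;
    apply: le_trans (bnd n); apply: ler_sum => k _;
    rewrite ler_pM2l// normc2E; case: (v k.+1 x) (v k x) => ? ? [? ?] /=.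
    by rewrite lerDl sqr_ge0.
  by rewrite lerDr sqr_ge0.
(* An upper limit is measurable without any knowledge of the points of convergence; its values on
   the exceptional null set do not matter. *)
pose F x : C := fine (limn_esup (fun k => (complex.Re (v k x))%:E)) +i*
                fine (limn_esup (fun k => (complex.Im (v k x))%:E)).
have mF1 : measurable_fun setT (fun x => complex.Re (F x)).
  apply: (measurableT_comp (fine_measurable measurableT)).
  apply: measurable_fun_limn_esup => k; apply/measurable_EFinP.
  by have /sq_integrableP[] := vi k.
have mF2 : measurable_fun setT (fun x => complex.Im (F x)).
  apply: (measurableT_comp (fine_measurable measurableT)).
  apply: measurable_fun_limn_esup => k; apply/measurable_EFinP.
  by have /sq_integrableP[] := vi k.
have FE x : (\sum_(k <oo) (D k x)%:E)%E \is a fin_num ->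
    complex.Re (v k x) @[k --> \oo] --> complex.Re (F x) /\
    complex.Im (v k x) @[k --> \oo] --> complex.Im (F x).
  move=> /cvgRe[/cvg_ex[a va] /cvg_ex[b vb]]; rewrite /F/=.
  have /cvg_limn_einf_sup[_ ->] : (complex.Re (v k x))%:E @[k --> \oo] --> a%:E.
    exact/cvg_EFin/va/nearW.
  have /cvg_limn_einf_sup[_ ->] : (complex.Im (v k x))%:E @[k --> \oo] --> b%:E.
    exact/cvg_EFin/vb/nearW.
  by [].
have mun n : measurable_fun setT (fun x => complex.Re (F x - repr (u n) x)) /\
    measurable_fun setT (fun x => complex.Im (F x - repr (u n) x)).
  have /sq_integrableP[m1 m2 _] := mem_repr (u n).
  split.
    rewrite (_ : (fun x => _) = (fun x => complex.Re (F x) - complex.Re (repr (u n) x))).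
      exact: measurable_funB.
    by apply/funext => x; case: (F x) (repr (u n) x) => ? ? [].
  rewrite (_ : (fun x => _) = (fun x => complex.Im (F x) - complex.Im (repr (u n) x))).
    exact: measurable_funB.
  by apply/funext => x; case: (F x) (repr (u n) x) => ? ? [].
(* Fatou's lemma: the squared distance from [F] to [u n] is the lower limit, almost everywhere, of
   the squared distances from the [v k]. *)
have bound e n K : (forall k, (K <= k)%N -> L2_norm (u (M k) - u n) <= e) ->
    (\int[mu]_x (normc (F x - repr (u n) x) ^+ 2)%:E <= (e ^+ 2)%:E)%E.
  move=> Ke.
  rewrite (@ae_eq_integral _ _ _ _ _
      (fun x => limn_einf (fun k => (normc (v k x - repr (u n) x) ^+ 2)%:E)))//.
  - apply: le_trans (fatou _ _ _ _) _ => //.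
    + by move=> k; apply: measurable_normc2; apply: Bi => //; exact: mem_repr.
    + by move=> k x _; rewrite lee_fin sqr_ge0.
    + apply: (@limn_einf_le _ _ K) => k Kk.
      rewrite -(@L2_norm_ae (u (M k) - u n))//; last first.
        by apply: Bi => //; exact: mem_repr.
      by rewrite lee_fin lerXn2r ?nnegrE ?L2_norm_ge0 ?Ke// (le_trans (L2_norm_ge0 _)
        (Ke _ Kk)).
  - apply/measurable_EFinP; under eq_fun do rewrite normc2E.
    by have [? ?] := mun n; apply: measurable_funD; exact: measurable_funX.
  - have -> : (fun x => limn_einf (fun k => (normc (v k x - repr (u n) x) ^+ 2)%:E)) =
      (fun x => - limn_esup (fun k => (- ((normc (v k x - repr (u n) x) ^+ 2)%:E))))%E.
      by apply/funext => x; rewrite -limn_einfN; congr limn_einf; apply/funext => k;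
        exact/esym/oppeK.
    apply: measurableT_comp => //; apply: measurable_fun_limn_esup => k.
    apply: measurableT_comp => //.
    by apply: measurable_normc2; apply: Bi => //; exact: mem_repr.
  - apply: filterS good => x /(_ I) /FE[c1 c2] _.
    apply/esym; apply: (cvg_limn_einf_sup _).1.
    apply: cvg_EFin; first exact: nearW.
    rewrite normc2E /comp/=; under eq_fun do rewrite normc2E.
    have ReB (z w : C) : complex.Re (z - w) = complex.Re z - complex.Re w.
      by case: z w => ? ? [].
    have ImB (z w : C) : complex.Im (z - w) = complex.Im z - complex.Im w.
      by case: z w => ? ? [].
    rewrite ReB ImB; under eq_fun do rewrite ReB ImB.
    have sq (w : R^nat) (l : R) : w k @[k --> \oo] --> l -> w k ^+ 2 @[k --> \oo] --> l
      ^+ 2.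
      by move=> wl; rewrite expr2; under eq_fun do rewrite expr2; exact: cvgM.
    exact: cvgD (sq _ _ (cvgB c1 (cvg_cst _))) (sq _ _ (cvgB c2 (cvg_cst _))).
have ebound e : 0 < e -> exists N0, forall n, (N0 <= n)%N ->
    (\int[mu]_x (normc (F x - repr (u n) x) ^+ 2)%:E <= (e ^+ 2)%:E)%E.
  move=> /uC[N0 N0P]; exists N0 => n N0n; apply: (bound _ _ N0) => k N0k.
  by apply: N0P => //; rewrite (leq_trans N0k)// leq_addl.
have Fi : F \in sqi.
  have [N1 N1P] := ebound 1 ltr01.
  have [m1 m2] := mun N1.
  have FBi : (fun x => F x - repr (u N1) x) \in sqi.
    by apply/sq_integrableP; split => //; apply: le_lt_trans (N1P _ _) _; rewrite ?ltry.
  have := rpredD FBi (mem_repr (u N1)).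
  suff -> : (fun x => F x - repr (u N1) x) + L2fun_val (repr (u N1)) = F by [].
  by apply/funext => x; rewrite !fctE subrK.
exists (\pi_(H)%qT (MkL2fun Fi)).
apply/cvgrPdist_le => e e0; have [N0 N0P] := ebound e e0.
exists N0 => // n /= N0n; rewrite sub0r normrN ger0_norm ?L2_norm_ge0//.
have e0' := ltW e0.
rewrite -(@ler_pXn2r _ 2) ?nnegrE ?L2_norm_ge0// -lee_fin.
rewrite (@L2_norm_ae _ (fun x => repr (u n) x - F x)).
- apply: le_trans (N0P n N0n); rewrite le_eqVlt; apply/orP; left; apply/eqP.
  by apply: eq_integral => x _; rewrite -normcN opprB.
- by apply: Bi => //; exact: mem_repr.
- apply: filterS2 (repr_sub (u n) (\pi_(H)%qT (MkL2fun Fi))) (ae_repr (MkL2fun Fi)).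
  by move=> x -> ->.
Qed.
End L2Complete.
(** * Translations and time-frequency shifts *)

Section Translation.
Context (R : realType).
Local Open Scope ereal_scope.

Lemma measurable_subr_const (a : R) :
  measurable_fun setT (fun x : measurableTypeR R => (x - a)%R : measurableTypeR R).
Proof. exact: measurable_funB. Qed.

(** The pushforward of Lebesgue measure under x - a gives each half-open interval its length, and
    this determines a Borel measure. *)
Lemma lebesgue_measure_translation (a : R) (f : measurableTypeR R -> \bar R) :
  measurable_fun setT f -> (forall x, 0 <= f x) ->
  \int[@lebesgue_measure R]_x f (x - a)%R = \int[@lebesgue_measure R]_x f x.
Proof.
move=> mf f0; pose tau (x : measurableTypeR R) : measurableTypeR R := (x - a)%R.
have mtau : measurable_fun setT tau by exact: measurable_subr_const.
have H := @ge0_integral_pushforward _ _ _ _ R tau mtau (@lebesgue_measure R) setT f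
  measurableT mf (fun y _ => f0 y).
rewrite -[LHS]H.
pose nu := measure_function_pushforward__canonical__measure_function_Measure
  (@lebesgue_measure R) mtau.
apply: (@eq_measure_integral _ _ R setT (@lebesgue_measure R) nu) => A mA _.
symmetry; apply: (@lebesgue_measure_unique R nu) => // _ [[x y] _ <-] /=.
rewrite /pushforward (_ : tau @^-1` _ = `]x + a, y + a]%classic)%R; last first.
  by apply/seteqP; split => z /=; rewrite !in_itv/= ltrBrDr lerBlDr.
rewrite !lebesgue_measure_itv/= !lte_fin ltrD2r; case: ifP => // _.
by rewrite -!EFinB; congr (_%:E); ring.
Qed.

Lemma measurable_euclid_sub d (x : euclidean R d) :
  measurable_fun setT (fun y : euclidean R d => euclid_sub y x).
Proof.
apply/measurable_fun_tnthP => i.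
rewrite (_ : _ \o _ = (fun y : euclidean R d => (tnth y i : R) - tnth x i)%R).
  apply: (measurableT_comp (measurable_subr_const _)).
  exact: measurable_tnth.
by apply/funext => y /=; rewrite tnth_mktuple.
Qed.

Lemma euclid_sub_cons d (a : R) (t : euclidean R d) (x : euclidean R d.+1) :
  euclid_sub (cons_pair (a, t)) x =
  cons_pair ((a - thead x)%R, euclid_sub t [tuple of behead x]).
Proof.
apply: eq_from_tnth => i; rewrite tnth_mktuple.
case: (unliftP ord0 i) => [j ->|->]; rewrite ?tnth0//.
rewrite /cons_pair/= !tnthS tnth_mktuple tnth_behead; congr (_ - tnth x _)%R.
by apply: val_inj; rewrite /= inordK// ltnS.
Qed.

Lemma integral_lebesgue_step d (f : euclidean R d.+1 -> \bar R) :
  measurable_fun setT f -> (forall x, 0 <= f x) ->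
  \int[lebesgue_rn d.+1]_x f x =
  \int[@lebesgue_measure R]_a \int[lebesgue_rn d]_t f (cons_pair (a, t)).
Proof.
move=> mf f0.
transitivity (\int[prod_measure (@lebesgue_measure R) (lebesgue_rn d)]_p f (cons_pair p)).
  exact: (@ge0_integral_pushforward _ _ _ _ R _ (@measurable_cons_pair R d) 
    (prod_measure (@lebesgue_measure R) (lebesgue_rn d)) setT f measurableT mf (fun y _
      => f0 y)).
apply: (@fubini_tonelli1 _ _ _ _ R (@lebesgue_measure R) (lebesgue_rn d) (f \o
  @cons_pair R d)).
  by apply: measurableT_comp => //; exact: measurable_cons_pair.
by move=> x; exact: f0.
Qed.

(** Induction on the dimension: Tonelli splits off the first coordinate, the inner integral is
    invariant by induction and the outer one by the case of the line. *)
Lemma integral_euclid_sub d (x : euclidean R d) (f : euclidean R d -> \bar R) :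
  measurable_fun setT f -> (forall x, 0 <= f x) ->
  \int[lebesgue_rn d]_y f (euclid_sub y x) = \int[lebesgue_rn d]_y f y.
Proof.
elim: d x f => [|d IH] x f mf f0.
  by apply: eq_integral => y _; congr f; rewrite (tuple0 (euclid_sub y x)) (tuple0 y).
rewrite !integral_lebesgue_step//; last first.
  by apply: measurableT_comp mf _; exact: measurable_euclid_sub.
under eq_integral do under eq_integral do rewrite euclid_sub_cons.
pose g a := \int[lebesgue_rn d]_t f (cons_pair (a, t)).
have mfc : measurable_fun setT (f \o @cons_pair R d).
  by apply: measurableT_comp => //; exact: measurable_cons_pair.
transitivity (\int[@lebesgue_measure R]_a g (a - thead x)%R).
  apply: eq_integral => a _.
  apply: (IH _ (fun t => f (cons_pair ((a - thead x)%R, t)))) => //.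
  apply: measurableT_comp mfc _; exact: measurable_pair1.
apply: (@lebesgue_measure_translation _ g).
  exact: (@measurable_fun_fubini_tonelli_F _ _ _ _ R (lebesgue_rn d) _ mfc (fun x => f0 _)).
by move=> a; rewrite /g; apply: integral_ge0.
Qed.

End Translation.

(** * Measurability of complex-valued functions *)

Section ComplexMeasurable.
Context (R : realType).
Local Notation C := (R[i]).

Definition cmeasurable dT (T : measurableType dT) (f : T -> C) : Prop :=
  measurable_fun setT (fun x => complex.Re (f x)) /\
  measurable_fun setT (fun x => complex.Im (f x)).

Lemma cmeasurable_cst dT (T : measurableType dT) (c : C) :
  cmeasurable (fun _ : T => c).
Proof. by split; exact: measurable_cst. Qed.

Lemma cmeasurableM dT (T : measurableType dT) (f g : T -> C) :
  cmeasurable f -> cmeasurable g -> cmeasurable (fun x => f x * g x).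
Proof.
move=> [f1 f2] [g1 g2]; split.
  rewrite (_ : (fun x => _) = fun x => complex.Re (f x) * complex.Re (g x) -
      complex.Im (f x) * complex.Im (g x)).
    by apply: measurable_funB; exact: measurable_funM.
  by apply/funext => x; case: (f x) (g x) => ? ? [].
rewrite (_ : (fun x => _) = fun x => complex.Re (f x) * complex.Im (g x) +
    complex.Im (f x) * complex.Re (g x)).
  by apply: measurable_funD; exact: measurable_funM.
by apply/funext => x; case: (f x) (g x) => ? ? [].
Qed.

Lemma cmeasurableD dT (T : measurableType dT) (f g : T -> C) :
  cmeasurable f -> cmeasurable g -> cmeasurable (fun x => f x + g x).
Proof.
move=> [f1 f2] [g1 g2]; split.
  rewrite (_ : (fun x => _) = fun x => complex.Re (f x) + complex.Re (g x)).
    exact: measurable_funD.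
  by apply/funext => x; case: (f x) (g x) => ? ? [].
rewrite (_ : (fun x => _) = fun x => complex.Im (f x) + complex.Im (g x)).
  exact: measurable_funD.
by apply/funext => x; case: (f x) (g x) => ? ? [].
Qed.

Lemma cmeasurable_conj dT (T : measurableType dT) (f : T -> C) :
  cmeasurable f -> cmeasurable (fun x => (f x)^*%C).
Proof.
move=> [f1 f2]; split.
  by rewrite (_ : (fun x => _) = fun x => complex.Re (f x))//; apply/funext => x;
    case: (f x).
rewrite (_ : (fun x => _) = fun x => - complex.Im (f x)).
  exact: (measurableT_comp (@oppr_measurable R setT) f2).
by apply/funext => x; case: (f x).
Qed.

Lemma cmeasurable_sum dT (T : measurableType dT) (n : nat) (f : nat -> T -> C) :
  (forall k, cmeasurable (f k)) -> cmeasurable (fun x => \sum_(k < n) f k x).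
Proof.
move=> fm; elim: n => [|n IH].
  by under eq_fun do rewrite big_ord0; exact: cmeasurable_cst.
by under eq_fun do rewrite big_ord_recr/=; exact: cmeasurableD.
Qed.

Lemma cmeasurable_comp d1 d2 (T1 : measurableType d1) (T2 : measurableType d2)
    (f : T2 -> C) (h : T1 -> T2) :
  cmeasurable f -> measurable_fun setT h -> cmeasurable (fun x => f (h x)).
Proof.
move=> [f1 f2] mh; split.
  exact: (measurableT_comp f1 mh).
exact: (measurableT_comp f2 mh).
Qed.

Lemma measurable_normc dT (T : measurableType dT) (f : T -> C) :
  cmeasurable f -> measurable_fun setT (fun x => normc (f x)).
Proof.
move=> [f1 f2].
rewrite (_ : (fun x => _) =
    fun x => Num.sqrt (complex.Re (f x) ^+ 2 + complex.Im (f x) ^+ 2)).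
  apply: (measurableT_comp (continuous_measurable_fun (@sqrt_continuous R))).
  by apply: measurable_funD; exact: measurable_funX.
by apply/funext => x; case: (f x).
Qed.

(** A real integral is the finite part of the difference of the integrals of the positive and the
    negative part, and Tonelli makes each of these measurable in the parameter. *)
Lemma cmeasurable_integral d1 d2 (T1 : measurableType d1) (T2 : measurableType d2)
    (m : {sigma_finite_measure set T2 -> \bar R}) (F : T1 * T2 -> C) :
  cmeasurable F ->
  cmeasurable (fun z => (\int[m]_y complex.Re (F (z, y)))%R +i*
                        (\int[m]_y complex.Im (F (z, y)))%R).
Proof.
have key (G : T1 * T2 -> R) : measurable_fun setT G ->
    measurable_fun setT (fun z => \int[m]_y G (z, y)).
  move=> mG; apply: (measurableT_comp (fine_measurable measurableT)).
  pose G' := EFin \o G.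
  have mG' : measurable_fun setT G' by exact/measurable_EFinP.
  rewrite (_ : (fun z => _) = fun z =>
      (\int[m]_y (G'^\+ (z, y)) - \int[m]_y (G'^\- (z, y)))%E).
    apply: emeasurable_funB.
      apply: (@measurable_fun_fubini_tonelli_F _ _ _ _ R m) => //.
      exact: measurable_funepos.
    apply: (@measurable_fun_fubini_tonelli_F _ _ _ _ R m) => //.
    exact: measurable_funeneg.
  apply/funext => z; rewrite [LHS]integralE.
  by congr (_ - _)%E; apply: eq_integral => y _; rewrite ?funeposE ?funenegE.
by move=> [m1 m2]; split; [exact: (key _ m1)|exact: (key _ m2)].
Qed.

End ComplexMeasurable.

(** * Time-frequency shifts on L2 *)

Section TfShift.
Context (R : realType) (d : nat).
Local Notation C := (R[i]).
Local Notation E := (euclidean R d).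
Local Notation mu := (@lebesgue_rn R d).
Local Notation H := (L2 R d).
Local Notation sqi := (@sq_integrable R d).

Lemma normc_cexpi (t : R) : normc (cexpi t) = 1.
Proof. by rewrite /cexpi /= cos2Dsin2 sqrtr1. Qed.

(** The preimage of a null set under a translation is null, as one sees by integrating the
    indicators. *)
Lemma ae_euclid_sub (x : E) (P : E -> Prop) :
  {ae mu, forall y, P y} -> {ae mu, forall y, P (euclid_sub y x)}.
Proof.
move=> [N [mN N0 PN]]; exists ((fun y : E => euclid_sub y x) @^-1` N); split.
- by rewrite -[X in measurable X]setTI; exact: measurable_euclid_sub.
- have mi : measurable_fun setT (fun y : E => (\1_N y)%:E : \bar R).
    by apply/measurable_EFinP; exact: measurable_indic.
  have i0 (y : E) : (0 <= (\1_N y)%:E :> \bar R)%E by rewrite lee_fin.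
  have mN' : measurable ((fun y : E => euclid_sub y x) @^-1` N).
    by rewrite -[X in measurable X]setTI; exact: measurable_euclid_sub.
  have e1 := integral_indic mu measurableT mN.
  have e2 := integral_indic mu measurableT mN'.
  rewrite setIT in e1; rewrite setIT in e2.
  by rewrite -e2 -N0 -e1; exact: (integral_euclid_sub x mi i0).
- by move=> y /= nP; apply: PN => /= Py; exact: nP.
Qed.

(** The function whose class is [tf_shift z f], when applied to [repr f]. Unlike a chosen
    representative of that class, it depends explicitly on z. *)
Definition tf_fun (z : E * E) (f : E -> C) (y : E) : C :=
  cexpi (2 * pi * euclid_dot z.2 y) * f (euclid_sub y z.1).

Let measurable_tnth_fst (i : 'I_d) :
  measurable_fun setT (fun p : E * E => tnth p.1 i : R).
Proof. exact: (measurableT_comp (measurable_tnth i) measurable_fst). Qed.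

Let measurable_tnth_snd (i : 'I_d) :
  measurable_fun setT (fun p : E * E => tnth p.2 i : R).
Proof. exact: (measurableT_comp (measurable_tnth i) measurable_snd). Qed.

Lemma measurable_euclid_sub2 :
  measurable_fun setT (fun p : E * E => euclid_sub p.2 p.1).
Proof.
apply/measurable_fun_tnthP => i.
rewrite (_ : _ \o _ = (fun p : E * E => (tnth p.2 i : R) - tnth p.1 i)).
  exact: measurable_funB (measurable_tnth_snd i) (measurable_tnth_fst i).
by apply/funext => y /=; rewrite tnth_mktuple.
Qed.

Lemma measurable_euclid_dot :
  measurable_fun setT (fun p : E * E => euclid_dot p.1 p.2).
Proof.
apply: measurable_sum => i.
exact: measurable_funM (measurable_tnth_fst i) (measurable_tnth_snd i).
Qed.

(** Measurability is joint in (z, y), so that y can be integrated out and measurability in z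
    remains. *)
Lemma cmeasurable_tf_fun (f : E -> C) : cmeasurable f ->
  cmeasurable (fun p : (E * E) * E => tf_fun p.1 f p.2).
Proof.
have m12 : measurable_fun setT (fun p : (E * E) * E => (p.1.2, p.2)).
  exact: measurable_fun_pair (measurableT_comp measurable_snd measurable_fst)
    measurable_snd.
have m11 : measurable_fun setT (fun p : (E * E) * E => (p.1.1, p.2)).
  exact: measurable_fun_pair (measurableT_comp measurable_fst measurable_fst)
    measurable_snd.
have m : measurable_fun setT (fun p : (E * E) * E => 2 * pi * euclid_dot p.1.2 p.2).
  by apply: measurable_funM => //; exact: (measurableT_comp measurable_euclid_dot m12).
move=> mf; apply: cmeasurableM.
  split.
    exact: (measurableT_comp (continuous_measurable_fun (@continuous_cos R)) m).
  exact: (measurableT_comp (continuous_measurable_fun (@continuous_sin R)) m).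
exact: (cmeasurable_comp mf (measurableT_comp measurable_euclid_sub2 m11)).
Qed.

Lemma cmeasurable_sqi (f : E -> C) : f \in sqi -> cmeasurable f.
Proof. by move=> /sq_integrableP[]. Qed.

Lemma normc_tf_fun (z : E * E) (f : E -> C) y :
  normc (tf_fun z f y) = normc (f (euclid_sub y z.1)).
Proof. by rewrite normcM normc_cexpi mul1r. Qed.

Lemma integral_tf_fun (z : E * E) (f : E -> C) : f \in sqi ->
  (\int[mu]_y (normc (tf_fun z f y) ^+ 2)%:E = \int[mu]_y (normc (f y) ^+ 2)%:E)%E.
Proof.
move=> fi; under eq_integral do rewrite normc_tf_fun.
apply: (integral_euclid_sub z.1 (measurable_normc2 fi)).
by move=> x; rewrite lee_fin sqr_ge0.
Qed.

Lemma tf_fun_sqi (z : E * E) (f : E -> C) : f \in sqi -> tf_fun z f \in sqi.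
Proof.
move=> fi; have /sq_integrableP[_ _ foo] := fi; apply/sq_integrableP.
rewrite integral_tf_fun//.
have [m1 m2] := cmeasurable_comp (cmeasurable_tf_fun (cmeasurable_sqi fi))
  (pair1_measurable z).
by split.
Qed.

(** Since [tf_fun] preserves square integrability, the default value of [insubd] in [L2_class] never
    occurs. *)
Lemma repr_tf_shift (z : E * E) (f : H) :
  {ae mu, forall y, repr (tf_shift z f) y = tf_fun z (repr f) y}.
Proof.
have fi := tf_fun_sqi z (mem_repr f).
have := ae_repr (insubd (0 : L2fun R d) (tf_fun z (repr f))).
apply: filterS => y; rewrite -[\pi_(H)%qT _]/(tf_shift z f) => ->.
by rewrite -[L2fun_val _]/(val _) val_insubd fi.
Qed.

Lemma tf_shift_lin (z : E * E) : linear (tf_shift z : H -> H).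
Proof.
move=> a f g; apply: eq_L2.
have h1 := repr_tf_shift z (a *: f + g).
have h2 := repr_lin a (tf_shift z f) (tf_shift z g).
(* Linearity of representatives holds only almost everywhere, and here it is needed at the
   translated point. *)
have h3 := ae_euclid_sub z.1 (repr_lin a f g).
have h4 := repr_tf_shift z f; have h5 := repr_tf_shift z g.
apply: filterS (filterI h1 (filterI h2 (filterI h3 (filterI h4 h5)))).
move=> y [-> [-> [e3 [-> ->]]]].
by rewrite /tf_fun e3 mulrDr mulrCA.
Qed.

Lemma L2_norm_tf_shift (z : E * E) (f : H) : L2_norm (tf_shift z f) = L2_norm f.
Proof.
apply/eqP; rewrite -(@eqrXn2 _ 2) ?L2_norm_ge0//; apply/eqP; apply: EFin_inj.
rewrite (L2_norm_ae (tf_fun_sqi z (mem_repr f)))//; last exact: repr_tf_shift.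
rewrite (L2_norm_ae (mem_repr f))//; last exact: nearW.
by rewrite integral_tf_fun// mem_repr.
Qed.

(** [repr (tf_shift z f)] is chosen separately for each z; replacing it by [tf_fun] leaves every
    inner product unchanged and makes the integrand jointly measurable. *)
Lemma cmeasurable_tf_dot (f g : H) :
  cmeasurable (fun z : E * E => L2_dot (tf_shift z f) g).
Proof.
rewrite (_ : (fun z => _) = (fun z : E * E => fun_dot (tf_fun z (repr f)) (repr g))).
  apply: (@cmeasurable_integral R _ _ (E * E)%type E mu
    (fun p => tf_fun p.1 (repr f) p.2 * (repr g p.2)^*%C)).
  apply: cmeasurableM.
    by apply: cmeasurable_tf_fun; apply: cmeasurable_sqi; exact: mem_repr.
  apply: cmeasurable_conj; apply: (@cmeasurable_comp R _ _ _ _ (repr g) snd) => //.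
  by apply: cmeasurable_sqi; exact: mem_repr.
apply/funext => z; apply: fun_dot_ae; rewrite ?mem_repr//.
- by apply: tf_fun_sqi; exact: mem_repr.
- exact: repr_tf_shift.
- exact: nearW.
Qed.

End TfShift.

(** * L2 is not the zero space *)

Section Nontrivial.
Context (R : realType).

Lemma L2_dot0l (d : nat) (h : L2 R d) : L2_dot 0 h = 0.
Proof.
have := L2_dot_lin 1 0 0 h; rewrite scale1r addr0 mul1r => /eqP.
by rewrite -subr_eq subrr => /eqP.
Qed.

Lemma lebesgue_rn_setT_neq0 (d : nat) : @lebesgue_rn R d setT <> 0%E.
Proof.
have lT : @lebesgue_measure R setT = +oo%E.
  have := @lebesgue_measure_itv R `]-oo, +oo[%R.
  by rewrite set_itvNyy => ->; rewrite (_ : (_ < _)%E = true).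
elim: d => [|d IH].
  by rewrite /= diracT => /eqP; rewrite onee_eq0.
have m1 n : measurable_fun [set: euclidean R n] (fun=> 1%:E : \bar R).
  exact: measurable_cst.
have -> : lebesgue_rn d.+1 [set: euclidean R d.+1] =
    (\int[@lebesgue_rn R d.+1]_x 1%:E)%E by rewrite integral_cst// mul1e.
rewrite integral_lebesgue_step//.
under eq_integral do rewrite integral_cst// mul1e.
(* The inner integral is the measure of R^d, which may be infinite; that case is compared with the
   constant 1. *)
have claim (c : \bar R) : (0 <= c)%E -> c <> 0%E ->
    (\int[@lebesgue_measure R]_x c)%E <> 0%E.
  case: c => [r| |] //= r0 rn0.
    rewrite (integral_cst _ measurableT) => h.
    have : (r%:E * +oo = 0)%E by rewrite -[RHS]h; congr (_ * _)%E; exact/esym/lT.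
    by move=> /eqP; rewrite mule_eq0/= orbF => /eqP.
  move=> h.
  have : (\int[@lebesgue_measure R]_x 1 <= \int[@lebesgue_measure R]_x +oo)%E.
    by apply: ge0_le_integral => // x _; rewrite leey.
  rewrite h (integral_cst _ measurableT) mul1e; apply/negP; rewrite -ltNge.
  have : (0 < @lebesgue_measure R setT)%E by rewrite lT.
  by [].
by apply: claim => //; exact: measure_ge0.
Qed.

(** Some piece of a sigma-finite cover has positive finite measure, and its indicator is a nonzero
    class. This makes the identity a nonzero operator when no orthonormal basis is at hand. *)
Lemma L2_nontrivial (d : nat) : exists f : L2 R d, f <> 0.
Proof.
have [F FT Ffin] := sigma_finiteT (@lebesgue_rn R d).
have [k Fk0] : exists k, lebesgue_rn d (F k) <> 0%E.
  apply: contrapT => /forallNP F0; apply: (@lebesgue_rn_setT_neq0 d).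
  apply/eqP; rewrite eq_le measure_ge0 andbT FT.
  apply: le_trans (measure_sigma_subadditive _ _ _ (@subset_refl _ _)) _.
  - by move=> k; have [] := Ffin k.
  - by apply: bigcupT_measurable => k; have [] := Ffin k.
  - by rewrite eseries0// => k _ _; apply: contrapT; exact: F0.
have [mF Ff] := Ffin k.
pose f : euclidean R d -> R[i] := fun x => \1_(F k) x +i* 0.
have nf x : normc (f x) ^+ 2 = \1_(F k) x.
  by rewrite /f /= expr0n addr0 sqr_sqrtr ?sqr_ge0// indicE; case: (x \in F k);
    rewrite ?expr1n ?expr0n.
have If : (\int[lebesgue_rn d]_x (normc (f x) ^+ 2)%:E = lebesgue_rn d (F k))%E.
  by under eq_integral do rewrite nf; rewrite integral_indic// setIT.
have fi : f \in @sq_integrable R d.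
  apply/sq_integrableP; split; [|exact: measurable_cst|by rewrite If].
  exact: measurable_indic.
exists (\pi_(L2 R d)%qT (MkL2fun fi)) => f0; apply: Fk0.
rewrite -If -(L2_norm_ae fi (ae_repr (MkL2fun fi))) f0 L2_norm_sqr.
by rewrite L2_dot0l.
Qed.
End Nontrivial.
(** * Orthonormal bases and adjoints *)

Section ComplexLimits.
Context (R : realType).
Local Notation C := (R[i]).
Implicit Types (z w : C) (u v : nat -> C).

Lemma ReD z w : complex.Re (z + w) = complex.Re z + complex.Re w.
Proof. by case: z w => ? ? []. Qed.

Lemma ImD z w : complex.Im (z + w) = complex.Im z + complex.Im w.
Proof. by case: z w => ? ? []. Qed.

Lemma ReM z w : complex.Re (z * w) =
  complex.Re z * complex.Re w - complex.Im z * complex.Im w.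
Proof. by case: z w => ? ? []. Qed.

Lemma ImM z w : complex.Im (z * w) =
  complex.Re z * complex.Im w + complex.Im z * complex.Re w.
Proof. by case: z w => ? ? []. Qed.

Lemma ReJ z : complex.Re z^*%C = complex.Re z. Proof. by case: z. Qed.

Lemma ImJ z : complex.Im z^*%C = - complex.Im z. Proof. by case: z. Qed.

Lemma complex_eq z w :
  complex.Re z = complex.Re w -> complex.Im z = complex.Im w -> z = w.
Proof. by case: z w => ? ? [? ?] /= -> ->. Qed.

Lemma conjcD z w : (z + w)^*%C = z^*%C + w^*%C. Proof. exact: rmorphD. Qed.

Lemma conjcM z w : (z * w)^*%C = z^*%C * w^*%C. Proof. exact: rmorphM. Qed.

Lemma normc_conj z : normc z^*%C = normc z.
Proof. by case: z => ? ? /=; rewrite sqrrN. Qed.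

Lemma normc_sqrE z : (normc z ^+ 2)%:C = z * z^*%C.
Proof.
rewrite normc2E; apply: complex_eq; rewrite ?ReM ?ImM ReJ ImJ /=; ring.
Qed.

Lemma Re_le_normc z : `|complex.Re z| <= normc z.
Proof.
rewrite -(@ler_pXn2r _ 2)// ?nnegrE ?normr_ge0 ?normc_ge0//.
by rewrite real_normK ?num_real// normc2E lerDl sqr_ge0.
Qed.

Lemma Im_le_normc z : `|complex.Im z| <= normc z.
Proof.
rewrite -(@ler_pXn2r _ 2)// ?nnegrE ?normr_ge0 ?normc_ge0//.
by rewrite real_normK ?num_real// normc2E lerDr sqr_ge0.
Qed.

Lemma Re_sum n u : complex.Re (\sum_(k < n) u k) = \sum_(k < n) complex.Re (u k).
Proof.
by elim: n => [|n IH]; rewrite ?big_ord0// !big_ord_recr/= ReD IH.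
Qed.

Lemma Im_sum n u : complex.Im (\sum_(k < n) u k) = \sum_(k < n) complex.Im (u k).
Proof.
by elim: n => [|n IH]; rewrite ?big_ord0// !big_ord_recr/= ImD IH.
Qed.

Lemma normc_sum n u : normc (\sum_(k < n) u k) <= \sum_(k < n) normc (u k).
Proof.
elim: n => [|n IH]; first by rewrite !big_ord0 normc0.
by rewrite !big_ord_recr/= (le_trans (le_normcD _ _))// lerD2r.
Qed.

(** Componentwise, in agreement with [trace], which takes the limits of the two parts separately. *)
Definition ccvg u (l : C) : Prop :=
  complex.Re (u n) @[n --> \oo] --> complex.Re l /\
  complex.Im (u n) @[n --> \oo] --> complex.Im l.

Lemma ccvg_unique u l l' : ccvg u l -> ccvg u l' -> l = l'.
Proof.
move=> [a b] [c e]; apply: complex_eq.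
  exact: (cvg_unique _ a c).
exact: (cvg_unique _ b e).
Qed.

Lemma ccvg_cst l : ccvg (fun=> l) l.
Proof. by split; exact: cvg_cst. Qed.

Lemma ccvg_bound u l (b : R^nat) :
  (forall n, normc (u n - l) <= b n) -> b n @[n --> \oo] --> (0 : R) -> ccvg u l.
Proof.
move=> ub b0.
have key (f : C -> R) : (forall z w, f (z + w) = f z + f w) ->
    (forall z, `|f z| <= normc z) -> f (u n) @[n --> \oo] --> f l.
  move=> fD fn; apply/cvgrPdist_le => e e0.
  move/cvgrPdist_le : b0 => /(_ e e0); apply: filterS => n.
  rewrite sub0r normrN => be; rewrite distrC.
  have -> : f (u n) - f l = f (u n - l).
    by apply/eqP; rewrite subr_eq -fD subrK.
  by apply: le_trans (fn _) _; apply: le_trans (ub n) _; rewrite (le_trans _ be)// ler_norm.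
split; apply: key => //; [exact: ReD|exact: Re_le_normc|exact: ImD|exact: Im_le_normc].
Qed.

Lemma ccvgM u v l l' : ccvg u l -> ccvg v l' -> ccvg (fun n => u n * v n) (l * l').
Proof.
move=> [a b] [c e]; split.
  by rewrite ReM; under eq_fun do rewrite ReM; exact: (cvgB (cvgM a c) (cvgM b e)).
by rewrite ImM; under eq_fun do rewrite ImM; exact: (cvgD (cvgM a e) (cvgM b c)).
Qed.

Lemma ccvgD u v l l' : ccvg u l -> ccvg v l' -> ccvg (fun n => u n + v n) (l + l').
Proof.
move=> [a b] [c e]; split.
  by rewrite ReD; under eq_fun do rewrite ReD; exact: (cvgD a c).
by rewrite ImD; under eq_fun do rewrite ImD; exact: (cvgD b e).
Qed.

Lemma ccvg_conj u l : ccvg u l -> ccvg (fun n => (u n)^*%C) l^*%C.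
Proof.
move=> [a b]; split.
  by rewrite ReJ; under eq_fun do rewrite ReJ.
by rewrite ImJ; under eq_fun do rewrite ImJ; exact: cvgN.
Qed.

Lemma ccvg_sum n (u : nat -> nat -> C) (l : nat -> C) :
  (forall k, ccvg (u^~ k) (l k)) ->
  ccvg (fun m => \sum_(k < n) u m k) (\sum_(k < n) l k).
Proof.
move=> ul; elim: n => [|n IH].
  by rewrite big_ord0; under eq_fun do rewrite big_ord0; exact: ccvg_cst.
by rewrite big_ord_recr; under eq_fun do rewrite big_ord_recr; exact: ccvgD.
Qed.

Lemma ccvg_normc u l : ccvg u l -> normc (u n) @[n --> \oo] --> normc l.
Proof.
have nE z : normc z = Num.sqrt (complex.Re z ^+ 2 + complex.Im z ^+ 2) by case: z.
move=> [a b]; rewrite nE; under eq_fun do rewrite nE.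
apply: (continuous_cvg _ (@sqrt_continuous R _)); rewrite !expr2.
under eq_fun do rewrite !expr2.
exact: (cvgD (cvgM a a) (cvgM b b)).
Qed.

End ComplexLimits.

(** * Inner product and norm of L2 *)

Section InnerProduct.
Context (R : realType) (d : nat).
Local Notation C := (R[i]).
Local Notation H := (L2 R d).
Implicit Types (f g h : H) (a : C).

Lemma L2_dotDl f g h : L2_dot (f + g) h = L2_dot f h + L2_dot g h.
Proof. by have := L2_dot_lin 1 f g h; rewrite scale1r mul1r. Qed.

Lemma L2_dotZl a f h : L2_dot (a *: f) h = a * L2_dot f h.
Proof. by have := L2_dot_lin a f 0 h; rewrite L2_dot0l !addr0. Qed.

Lemma L2_dotDr f g h : L2_dot h (f + g) = L2_dot h f + L2_dot h g.
Proof. by rewrite L2_dot_conj L2_dotDl conjcD -!L2_dot_conj. Qed.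

Lemma L2_dotZr a f h : L2_dot h (a *: f) = a^*%C * L2_dot h f.
Proof. by rewrite L2_dot_conj L2_dotZl conjcM -L2_dot_conj. Qed.

Lemma L2_dot0r h : L2_dot h 0 = 0.
Proof. by rewrite L2_dot_conj L2_dot0l conjc0. Qed.

Lemma L2_dotNl f h : L2_dot (- f) h = - L2_dot f h.
Proof. by rewrite -scaleN1r L2_dotZl mulN1r. Qed.

Lemma L2_dotBl f g h : L2_dot (f - g) h = L2_dot f h - L2_dot g h.
Proof. by rewrite L2_dotDl L2_dotNl. Qed.

Lemma L2_dotBr (f g h : H) : L2_dot h (f - g) = L2_dot h f - L2_dot h g.
Proof.
rewrite (L2_dot_conj (f - g) h) (L2_dot_conj f h) (L2_dot_conj g h) L2_dotBl.
exact: rmorphB.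
Qed.

Lemma L2_dot_suml n (F : nat -> H) h :
  L2_dot (\sum_(k < n) F k) h = \sum_(k < n) L2_dot (F k) h.
Proof.
elim: n => [|n IH]; first by rewrite !big_ord0 L2_dot0l.
by rewrite !big_ord_recr/= L2_dotDl IH.
Qed.

Lemma L2_dot_self f : L2_dot f f = (L2_norm f ^+ 2)%:C.
Proof.
rewrite L2_norm_sqr; apply: complex_eq => //=.
have := L2_dot_conj f f => /(congr1 (@complex.Im R)); rewrite ImJ => /eqP.
by rewrite -subr_eq0 opprK -mulr2n mulrn_eq0/= => /eqP.
Qed.

Lemma L2_normZ a f : L2_norm (a *: f) = normc a * L2_norm f.
Proof.
apply/eqP; rewrite -(@eqrXn2 _ 2) ?mulr_ge0 ?L2_norm_ge0 ?normc_ge0//.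
apply/eqP/complexI; rewrite -L2_dot_self L2_dotZl L2_dotZr L2_dot_self mulrA.
by rewrite -normc_sqrE -rmorphM exprMn.
Qed.

Lemma L2_normN f : L2_norm (- f) = L2_norm f.
Proof. by rewrite -scaleN1r L2_normZ normcN normc1 mul1r. Qed.

Lemma L2_norm0 : L2_norm (0 : H) = 0.
Proof. by rewrite /L2_norm L2_dot0l sqrtr0. Qed.

Lemma L2_norm_eq0 f : L2_norm f = 0 -> f = 0.
Proof. by move=> f0; apply: L2_dot_eq0; rewrite -L2_norm_sqr f0 expr0n. Qed.

Lemma L2_normD_sqr f g : L2_norm (f + g) ^+ 2 =
  L2_norm f ^+ 2 + 2 * complex.Re (L2_dot f g) + L2_norm g ^+ 2.
Proof.
rewrite !L2_norm_sqr L2_dotDl !L2_dotDr !ReD (L2_dot_conj f g) ReJ; ring.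
Qed.

Lemma L2_cauchy_schwarz f g : normc (L2_dot f g) <= L2_norm f * L2_norm g.
Proof.
have [/L2_norm_eq0 ->|g0] := eqVneq (L2_norm g) 0.
  by rewrite L2_dot0r normc0 mulr_ge0 ?L2_norm_ge0.
have gp : 0 < L2_norm g by rewrite lt0r g0 L2_norm_ge0.
(* With this scalar f + a g is the component of f orthogonal to g, of least norm among all f + a
   g. *)
pose a := - (L2_dot f g * ((L2_norm g ^+ 2)^-1)%:C).
have := sqr_ge0 (L2_norm (f + a *: g)).
rewrite L2_normD_sqr L2_normZ L2_dotZr.
have -> : complex.Re (a^*%C * L2_dot f g) = - (normc (L2_dot f g) ^+ 2 / L2_norm g ^+ 2).
  by rewrite normc2E /a; case: (L2_dot f g) => x y /=; ring.
have -> : normc a = normc (L2_dot f g) / L2_norm g ^+ 2.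
  by rewrite /a normcN normcM/= expr0n addr0 sqrtr_sqr ger0_norm// invr_ge0 sqr_ge0.
have -> : L2_norm f ^+ 2 + 2 * - (normc (L2_dot f g) ^+ 2 / L2_norm g ^+ 2) +
    (normc (L2_dot f g) / L2_norm g ^+ 2 * L2_norm g) ^+ 2 =
    L2_norm f ^+ 2 - normc (L2_dot f g) ^+ 2 / L2_norm g ^+ 2 by field.
rewrite subr_ge0 ler_pdivrMr ?exprn_gt0// -exprMn.
by rewrite ler_pXn2r// nnegrE ?mulr_ge0 ?L2_norm_ge0 ?normc_ge0.
Qed.

Lemma L2_normD f g : L2_norm (f + g) <= L2_norm f + L2_norm g.
Proof.
rewrite -(@ler_pXn2r _ 2)// ?nnegrE ?addr_ge0 ?L2_norm_ge0//.
rewrite L2_normD_sqr sqrrD lerD2r lerD2l -[leRHS]mulr_natl ler_pM2l//.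
by apply: le_trans (L2_cauchy_schwarz _ _); rewrite (le_trans _ (Re_le_normc _))// ler_norm.
Qed.

Lemma ccvg_dotl (u : nat -> H) f g :
  L2_norm (u n - f) @[n --> \oo] --> (0 : R) ->
  ccvg (fun n => L2_dot (u n) g) (L2_dot f g).
Proof.
move=> uf; apply: (@ccvg_bound _ _ _ (fun n => L2_norm (u n - f) * L2_norm g)) => [n|].
  by rewrite -L2_dotBl; exact: L2_cauchy_schwarz.
by rewrite -(mul0r (L2_norm g)); apply: cvgM => //; exact: cvg_cst.
Qed.

End InnerProduct.
(* Otherwise unification unfolds inner products down to the integrals. *)
Local Arguments normc : simpl never.
Local Arguments L2_dot : simpl never.
Local Opaque L2_dot.

(** * Expansions in an orthonormal basis and existence of adjoints *)

Section OrthonormalBasis.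
Context (R : realType) (d : nat).
Local Notation C := (R[i]).
Local Notation H := (L2 R d).

Definition lincomb (e : nat -> H) (c : nat -> C) (n : nat) : H :=
  \sum_(k < n) c k *: e k.

Section Orthonormal.
Variable e : nat -> H.
Hypothesis e_orth : forall i j, L2_dot (e i) (e j) = (i == j)%:R.

Lemma L2_dot_lincombl c n f :
  L2_dot (lincomb e c n) f = \sum_(k < n) c k * L2_dot (e k) f.
Proof.
rewrite /lincomb (L2_dot_suml _ (fun k => c k *: e k)).
by apply: eq_bigr => k _; rewrite L2_dotZl.
Qed.

Lemma L2_dot_lincomb_coef c n j : (j < n)%N ->
  L2_dot (lincomb e c n) (e j) = c j.
Proof.
move=> jn; rewrite L2_dot_lincombl (bigD1 (Ordinal jn))//= e_orth eqxx mulr1.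
rewrite big1 ?addr0// => k; rewrite -val_eqE/= => /negbTE kj.
by rewrite e_orth kj mulr0.
Qed.

Lemma L2_norm_lincomb c n :
  L2_norm (lincomb e c n) ^+ 2 = \sum_(k < n) normc (c k) ^+ 2.
Proof.
apply: complexI; rewrite -L2_dot_self L2_dot_lincombl rmorph_sum/=.
apply: eq_bigr => k _; rewrite L2_dot_conj L2_dot_lincomb_coef//.
by rewrite normc_sqrE.
Qed.

Lemma L2_norm_basis k : L2_norm (e k) = 1.
Proof.
apply/eqP; rewrite -(@eqrXn2 _ 2) ?L2_norm_ge0// L2_norm_sqr e_orth eqxx.
by rewrite expr1n.
Qed.

(** The gap between the two sides is the squared distance from f to its n-th partial expansion. *)
Lemma bessel f n :
  \sum_(k < n) normc (L2_dot f (e k)) ^+ 2 <= L2_norm f ^+ 2.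
Proof.
set c := fun k => L2_dot f (e k).
have := sqr_ge0 (L2_norm (f + (- 1) *: lincomb e c n)).
rewrite L2_normD_sqr L2_normZ L2_dotZr exprMn normcN normc1 expr1n mul1r.
rewrite (L2_norm_lincomb c n) (L2_dot_conj (lincomb e c n) f) (L2_dot_lincombl c n f).
have -> : \sum_(k < n) c k * L2_dot (e k) f = (\sum_(k < n) normc (c k) ^+ 2)%:C.
  rewrite rmorph_sum/=; apply: eq_bigr => k _.
  by rewrite L2_dot_conj normc_sqrE.
set s := \sum_(_ < n) _.
have -> : complex.Re ((- 1)^*%C * s%:C^*%C) = - s by rewrite ReM /=; ring.
lra.
Qed.

Lemma lincombD c m n :
  lincomb e c (m + n) - lincomb e c m = \sum_(k < n) c (m + k)%N *: e (m + k)%N.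
Proof. by rewrite /lincomb big_split_ord/= addrAC subrr add0r. Qed.

End Orthonormal.

(** By orthonormality the squared distance of two partial sums is a difference of partial sums of
    |c_k|^2, so completeness of L2 applies. *)
Lemma riesz_fischer_orth (e : nat -> H) (c : nat -> C) (M : R) :
  (forall i j, L2_dot (e i) (e j) = (i == j)%:R) ->
  (forall n, \sum_(k < n) normc (c k) ^+ 2 <= M) ->
  exists f, L2_norm (lincomb e c n - f) @[n --> \oo] --> (0 : R) /\
            forall k, L2_dot f (e k) = c k.
Proof.
move=> e_orth cM.
pose A := series (fun k => normc (c k) ^+ 2).
have AE n : A n = \sum_(k < n) normc (c k) ^+ 2 by rewrite /A /series/= big_mkord.
have A_nd : nondecreasing_seq A by apply: nondecreasing_series => k _ _; exact: sqr_ge0.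
have A_cvg : cvgn A.
  by apply: (is_cvg_series_bounded (M := M)) => [k|n];
    [rewrite sqr_ge0|rewrite -[leLHS]/(A n) AE].
have dist m n : (m <= n)%N -> L2_norm (lincomb e c n - lincomb e c m) ^+ 2 = A n - A m.
  move=> mn; rewrite -(subnKC mn) lincombD.
  rewrite -/(lincomb (fun k => e (m + k)%N) (fun k => c (m + k)%N) (n - m)).
  rewrite L2_norm_lincomb; last by move=> i j; rewrite e_orth eqn_add2l.
  by rewrite !AE big_split_ord/= addrAC subrr add0r.
have [f fP] : exists f, L2_norm (lincomb e c n - f) @[n --> \oo] --> (0 : R).
  apply: L2_complete => eps eps0.
  have e2 : 0 < eps ^+ 2 by rewrite exprn_gt0.
  have /cvgrPdist_le/(_ _ e2)[N _ NP] : A n @[n --> \oo] --> limn A by [].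
  exists N.
  have key m n : (N <= m)%N -> (m <= n)%N ->
      L2_norm (lincomb e c n - lincomb e c m) <= eps.
    move=> Nm mn; rewrite -(@ler_pXn2r _ 2)// ?nnegrE ?L2_norm_ge0 ?(ltW eps0)//.
    rewrite dist//; apply: (@le_trans _ _ (limn A - A m)).
      by rewrite lerD2r; exact: nondecreasing_cvgn_le.
    by apply: le_trans (NP m Nm); exact: ler_norm.
  move=> m n Nm Nn; have [mn|/ltnW nm] := leqP m n; last exact: key.
  by rewrite -opprB L2_normN key.
exists f; split => // k.
have h1 := ccvg_dotl (e k) fP.
apply: (ccvg_unique h1).
by split; apply: cvg_near_cst; exists k.+1 => // n kn;
  rewrite (L2_dot_lincomb_coef e_orth c kn).
Qed.

Section Basis.
Variable e : nat -> H.
Hypothesis e_basis : orthonormal_basis e.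

Let e_orth : forall i j, L2_dot (e i) (e j) = (i == j)%:R.
Proof. by have [] := e_basis. Qed.

Lemma L2_ext f g : (forall k, L2_dot f (e k) = L2_dot g (e k)) -> f = g.
Proof.
move=> fg; apply/eqP; rewrite -subr_eq0; apply/eqP; apply: (e_basis.2) => k.
by rewrite L2_dotBl fg subrr.
Qed.

Lemma riesz_fischer (c : nat -> C) (M : R) :
  (forall n, \sum_(k < n) normc (c k) ^+ 2 <= M) ->
  exists f, forall k, L2_dot f (e k) = c k.
Proof. by move=> /(riesz_fischer_orth e_orth)[f [_ fc]]; exists f. Qed.

(** The partial sums converge by Riesz-Fischer, and their limit has the same coefficients as f,
    hence equals f. *)
Lemma cvg_expansion f :
  L2_norm (lincomb e (fun k => L2_dot f (e k)) n - f) @[n --> \oo] --> (0 : R).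
Proof.
have [g [gP gc]] := @riesz_fischer_orth e (fun k => L2_dot f (e k)) _ e_orth
  (bessel e_orth f).
have gf : g = f by apply: L2_ext => k; rewrite gc.
by rewrite gf in gP.
Qed.

Lemma parseval_dot f g :
  ccvg (fun n => \sum_(k < n) L2_dot f (e k) * L2_dot (e k) g) (L2_dot f g).
Proof.
have := ccvg_dotl g (cvg_expansion f).
by under eq_fun do rewrite L2_dot_lincombl.
Qed.

Lemma parseval f :
  (\sum_(k <oo) (normc (L2_dot f (e k)) ^+ 2)%:E = (L2_norm f ^+ 2)%:E)%E.
Proof.
have [h _] := parseval_dot f f.
apply/cvg_lim => //; rewrite L2_norm_sqr.
have -> : (fun n => \sum_(0 <= k < n) (normc (L2_dot f (e k)) ^+ 2)%:E)%E =
    (fun n => (complex.Re (\sum_(k < n) L2_dot f (e k) * L2_dot (e k) f))%:E).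
  apply/funext => n; rewrite big_mkord sumEFin; congr (_%:E).
  rewrite (Re_sum _ (fun k => L2_dot f (e k) * L2_dot (e k) f)).
  by apply: eq_bigr => k _; rewrite (L2_dot_conj f (e k)) -normc_sqrE.
by apply: cvg_EFin h; exact: nearW.
Qed.

(** [B g] is the vector with coefficients c_k = <g, A e_k>. If S is a partial sum of |c_k|^2, then S
    = <A (sum c_k e_k), g> is at most M sqrt(S) |g|, which bounds S and makes [riesz_fischer]
    applicable. *)
Lemma adjoint_ex (A : H -> H) : linear A -> bounded_op A ->
  exists B : H -> H, forall f g, L2_dot (A f) g = L2_dot f (B g).
Proof.
move=> A_lin [M AM].
have A0 : A 0 = 0.
  by have := A_lin (- 1) 0 0; rewrite scaler0 addr0 scaleN1r addNr.
have AZ a f : A (a *: f) = a *: A f.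
  by have := A_lin a f 0; rewrite A0 !addr0.
have AD f g : A (f + g) = A f + A g by have := A_lin 1 f g; rewrite !scale1r.
have A_comb c n : A (lincomb e c n) = lincomb (A \o e) c n.
  rewrite /lincomb; elim: n => [|n IH].
    by rewrite !big_ord0 A0.
  by rewrite !big_ord_recr/= AD AZ IH.
have /choice[B BP] (g : H) : exists h, forall k, L2_dot h (e k) = L2_dot g (A (e k)).
  apply: (@riesz_fischer _ ((M * L2_norm g) ^+ 2)) => n.
  set c := fun k => L2_dot g (A (e k)).
  set S := \sum_(k < n) _.
  have S0 : 0 <= S by apply: sumr_ge0 => k _; exact: sqr_ge0.
  have SE : S%:C = L2_dot (A (lincomb e c n)) g.
    rewrite A_comb /lincomb (L2_dot_suml _ (fun k => c k *: A (e k))) rmorph_sum/=.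
    by apply: eq_bigr => k _; rewrite L2_dotZl (L2_dot_conj g) -normc_sqrE.
  have Ssqrt : L2_norm (lincomb e c n) = Num.sqrt S.
    by rewrite /S -(L2_norm_lincomb e_orth c n) sqrtr_sqr ger0_norm// L2_norm_ge0.
  have SM : S <= M * Num.sqrt S * L2_norm g.
    have SN : S = normc S%:C by rewrite /normc/= expr0n addr0 sqrtr_sqr ger0_norm.
    rewrite [leLHS]SN SE; apply: le_trans (L2_cauchy_schwarz _ _) _.
    by apply: ler_wpM2r; rewrite ?L2_norm_ge0// -Ssqrt.
  have [S_eq0|Sn0] := eqVneq S 0; first by rewrite S_eq0 sqr_ge0.
  have Sp : 0 < Num.sqrt S by rewrite sqrtr_gt0 lt0r Sn0.
  have : Num.sqrt S <= M * L2_norm g.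
    rewrite -(ler_pM2l Sp) -expr2 sqr_sqrtr//; apply: le_trans SM _.
    by rewrite mulrCA mulrA.
  rewrite -{2}(sqr_sqrtr S0) => h.
  by apply: lerXn2r => //; rewrite nnegrE ?(ltW Sp)// (le_trans (ltW Sp)).
exists B => f g.
(* The identity is known for f = e_k; boundedness of [A] carries it along the expansion of f. *)
have h1 : L2_norm (A (lincomb e (fun k => L2_dot f (e k)) n) - A f) @[n --> \oo] --> (0
  : R).
  have h := cvg_expansion f.
  have AB u v : A u - A v = A (u - v) by rewrite AD -scaleN1r -(scaleN1r v) AZ.
  apply: (@squeeze_cvgr _ _ _ _ (fun=> 0)
      (fun n => M * L2_norm (lincomb e (fun k => L2_dot f (e k)) n - f))).
  - by apply: nearW => n; rewrite L2_norm_ge0 AB AM.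
  - exact: cvg_cst.
  - by rewrite -(mulr0 M); apply: cvgM => //; exact: cvg_cst.
have h2 := ccvg_dotl g h1.
have h3 := parseval_dot f (B g).
apply: (ccvg_unique h2); move: h3; congr (ccvg _ _); apply/funext => n.
rewrite A_comb /lincomb (L2_dot_suml _ (fun k => L2_dot f (e k) *: A (e k))).
apply: eq_bigr => k _; rewrite L2_dotZl (L2_dot_conj (B g)) BP.
by rewrite (L2_dot_conj g (A (e k))).
Qed.

End Basis.
(** Two maps with the adjoint identity agree, as testing it against their difference shows. Hence
    the choice inside [adjoint] is computed by exhibiting any witness. *)
Lemma adjoint_unique (A B : H -> H) :
  (forall f g, L2_dot (A f) g = L2_dot f (B g)) -> adjoint A = B.
Proof.
move=> AB; rewrite /adjoint.
case: xgetP => [B' _ /= B'P|/(_ B) []//].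
apply/funext => g; apply/eqP; rewrite -subr_eq0; apply/eqP/L2_dot_eq0.
set h := B' g - B g.
have -> : L2_dot h h = 0; last by [].
by rewrite {1}/h L2_dotBl (L2_dot_conj h (B' g)) (L2_dot_conj h (B g)) -B'P -AB subrr.
Qed.

End OrthonormalBasis.
(** * Hilbert-Schmidt operators *)

Section SquareSummable.
Context (R : realType) (d : nat).
Local Notation C := (R[i]).
Local Notation H := (L2 R d).
Implicit Types (x y : nat -> H).

Lemma sum_cauchy_schwarz n (a b : nat -> R) :
  (forall k, 0 <= a k) -> (forall k, 0 <= b k) ->
  (\sum_(k < n) a k * b k) ^+ 2 <=
  (\sum_(k < n) a k ^+ 2) * (\sum_(k < n) b k ^+ 2).
Proof.
move=> a0 b0; elim: n => [|n IH]; first by rewrite !big_ord0 expr2 !mulr0.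
rewrite !big_ord_recr/=.
have : 0 <= \sum_(k < n) a k * b k by apply: sumr_ge0 => k _; rewrite mulr_ge0.
have : 0 <= \sum_(k < n) a k ^+ 2 by apply: sumr_ge0 => k _; rewrite sqr_ge0.
have : 0 <= \sum_(k < n) b k ^+ 2 by apply: sumr_ge0 => k _; rewrite sqr_ge0.
move: IH (a0 n) (b0 n).
move: (\sum_(k < n) a k * b k) (\sum_(k < n) a k ^+ 2) (\sum_(k < n) b k ^+ 2).
move=> S A B; move: (a n) (b n) => s t SAB s0 t0 B0 A0 S0.
(* The cross term of the new square: square both sides, use S^2 <= A B, and the difference is (A t^2
   - B s^2)^2. *)
have h : 2 * (S * (s * t)) <= A * t ^+ 2 + B * s ^+ 2.
  rewrite -(@ler_pXn2r _ 2)// ?nnegrE; last 2 first.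
  - by rewrite !mulr_ge0.
  - by rewrite addr_ge0// mulr_ge0// sqr_ge0.
  apply: (@le_trans _ _ (4 * (A * B) * (s * t) ^+ 2)).
    rewrite !exprMn -[2 ^+ 2]/(2 * 2) (_ : 2 * 2 = 4); last by ring.
    by rewrite mulrA -exprMn ler_wpM2r ?sqr_ge0// ler_wpM2l.
  rewrite -subr_ge0 (_ : _ - _ = (A * t ^+ 2 - B * s ^+ 2) ^+ 2) ?sqr_ge0//.
  by ring.
have -> : (S + s * t) ^+ 2 = S ^+ 2 + 2 * (S * (s * t)) + (s * t) ^+ 2 by ring.
have -> : (A + s ^+ 2) * (B + t ^+ 2) =
    A * B + (A * t ^+ 2 + B * s ^+ 2) + (s * t) ^+ 2 by ring.
by rewrite lerD2r lerD.
Qed.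

(* An operator T is encoded below as the sequence of the T^* e_k. *)
Definition ell2_sum x : \bar R := (\sum_(k <oo) (L2_norm (x k) ^+ 2)%:E)%E.

Definition ell2 x : Prop := (ell2_sum x < +oo)%E.

Lemma ell2_sum_ge0 x : (0 <= ell2_sum x)%E.
Proof. by apply: nneseries_ge0 => k _ _; rewrite lee_fin sqr_ge0. Qed.

Lemma ell2_bound x : ell2 x ->
  forall n, \sum_(k < n) L2_norm (x k) ^+ 2 <= fine (ell2_sum x).
Proof.
move=> xoo n; rewrite -lee_fin fineK; last by rewrite ge0_fin_numE// ell2_sum_ge0.
rewrite -sumEFin.
apply: le_trans (@nneseries_lim_ge _ (fun k => (L2_norm (x k) ^+ 2)%:E) xpredT 0 n _).
  by rewrite big_mkord.
by move=> k _ _; rewrite lee_fin sqr_ge0.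
Qed.

Lemma ell2_le x (M : R) :
  (forall n, \sum_(k < n) L2_norm (x k) ^+ 2 <= M) -> (ell2_sum x <= M%:E)%E.
Proof.
move=> xM; apply: lime_le.
  by apply: is_cvg_nneseries => k _ _; rewrite lee_fin sqr_ge0.
by apply: nearW => n; rewrite big_mkord sumEFin lee_fin.
Qed.

Lemma ell2_cvg x : ell2 x ->
  (fun n => \sum_(k < n) L2_norm (x k) ^+ 2) n @[n --> \oo] --> fine (ell2_sum x).
Proof.
move=> xoo.
have fx : ell2_sum x \is a fin_num by rewrite ge0_fin_numE// ell2_sum_ge0.
have h : (fun n => \sum_(0 <= k < n) (L2_norm (x k) ^+ 2)%:E)%E n @[n --> \oo]
    --> ell2_sum x.
  by apply: is_cvg_nneseries => k _ _; rewrite lee_fin sqr_ge0.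
rewrite -(fineK fx) in h.
apply: cvg_trans (fine_cvg h); apply: near_eq_cvg.
by apply: nearW => n /=; rewrite big_mkord sumEFin.
Qed.

(** The inner product of l^2(N; L2), written with the same two limits as [trace] so that [HS_dot]
    matches it term by term. *)
Definition ell2_dot x y : C :=
  limn (series (fun k => complex.Re (L2_dot (x k) (y k)))) +i*
  limn (series (fun k => complex.Im (L2_dot (x k) (y k)))).

Lemma ell2_dot_eq x y l :
  ccvg (fun n => \sum_(k < n) L2_dot (x k) (y k)) l -> ell2_dot x y = l.
Proof.
move=> [a b]; apply: complex_eq => /=; apply/cvg_lim => //.
  rewrite (_ : series _ = fun n => complex.Re (\sum_(k < n) L2_dot (x k) (y k)))//.
  apply/funext => n; rewrite /series/= big_mkord.
  by rewrite (Re_sum _ (fun k => L2_dot (x k) (y k))).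
rewrite (_ : series _ = fun n => complex.Im (\sum_(k < n) L2_dot (x k) (y k)))//.
apply/funext => n; rewrite /series/= big_mkord.
by rewrite (Im_sum _ (fun k => L2_dot (x k) (y k))).
Qed.

Lemma sum_dot_le x y n :
  \sum_(k < n) normc (L2_dot (x k) (y k)) <=
  Num.sqrt (\sum_(k < n) L2_norm (x k) ^+ 2) *
  Num.sqrt (\sum_(k < n) L2_norm (y k) ^+ 2).
Proof.
apply: (@le_trans _ _ (\sum_(k < n) L2_norm (x k) * L2_norm (y k))).
  by apply: ler_sum => k _; exact: L2_cauchy_schwarz.
have sx (z : nat -> H) : 0 <= \sum_(k < n) L2_norm (z k) ^+ 2.
  by apply: sumr_ge0 => k _; exact: sqr_ge0.
rewrite -sqrtrM// -[leLHS]ger0_norm; last first.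
  by apply: sumr_ge0 => k _; rewrite mulr_ge0// L2_norm_ge0.
rewrite -sqrtr_sqr ler_sqrt ?mulr_ge0//.
by apply: (@sum_cauchy_schwarz n (fun k => L2_norm (x k)) (fun k => L2_norm (y k)));
  move=> k; exact: L2_norm_ge0.
Qed.

Lemma ell2_sum_dot_le x y : ell2 x -> ell2 y -> forall n,
  \sum_(k < n) normc (L2_dot (x k) (y k)) <=
  Num.sqrt (fine (ell2_sum x)) * Num.sqrt (fine (ell2_sum y)).
Proof.
move=> xoo yoo n; apply: le_trans (sum_dot_le x y n) _.
by apply: ler_pM; rewrite ?sqrtr_ge0//; apply: ler_wsqrtr; exact: ell2_bound.
Qed.

Lemma cvg_norm_le_sum (u : nat -> R) (M : R) :
  (forall n, \sum_(k < n) `|u k| <= M) -> cvgn (series u).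
Proof.
move=> uM; apply: normed_cvg.
apply: (is_cvg_series_bounded (M := M)) => [k|n]; first exact: normr_ge0.
by apply: le_trans (uM n); rewrite /series/= big_mkord.
Qed.

Lemma ell2_dot_cvg x y : ell2 x -> ell2 y ->
  ccvg (fun n => \sum_(k < n) L2_dot (x k) (y k)) (ell2_dot x y).
Proof.
move=> xoo yoo.
have bnd := ell2_sum_dot_le xoo yoo.
split.
  have -> : (fun n => complex.Re (\sum_(k < n) L2_dot (x k) (y k))) =
      series (fun k => complex.Re (L2_dot (x k) (y k))).
    apply/funext => n; rewrite /series/= big_mkord.
    by rewrite (Re_sum _ (fun k => L2_dot (x k) (y k))).
  apply: cvg_norm_le_sum => n; apply: le_trans (bnd n).
  by apply: ler_sum => k _; exact: Re_le_normc.
have -> : (fun n => complex.Im (\sum_(k < n) L2_dot (x k) (y k))) =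
    series (fun k => complex.Im (L2_dot (x k) (y k))).
  apply/funext => n; rewrite /series/= big_mkord.
  by rewrite (Im_sum _ (fun k => L2_dot (x k) (y k))).
apply: cvg_norm_le_sum => n; apply: le_trans (bnd n).
by apply: ler_sum => k _; exact: Im_le_normc.
Qed.

Lemma ell2_dot_le x y : ell2 x -> ell2 y ->
  normc (ell2_dot x y) <= Num.sqrt (fine (ell2_sum x)) * Num.sqrt (fine (ell2_sum y)).
Proof.
move=> xoo yoo; have h := ccvg_normc (ell2_dot_cvg xoo yoo).
rewrite -(cvg_lim _ h)//; apply: limr_le; first by apply/cvg_ex; eexists; exact: h.
apply: nearW => n; apply: le_trans (normc_sum _ (fun k => L2_dot (x k) (y k))) _.
exact: ell2_sum_dot_le.
Qed.

Lemma ell2_dot_self x : ell2 x -> ell2_dot x x = (fine (ell2_sum x))%:C.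
Proof.
move=> xoo; apply: ell2_dot_eq.
have E n : \sum_(k < n) L2_dot (x k) (x k) = (\sum_(k < n) L2_norm (x k) ^+ 2)%:C.
  by rewrite rmorph_sum; apply: eq_bigr => k _; exact: L2_dot_self.
split; under eq_fun do rewrite E; first exact: ell2_cvg.
exact: cvg_cst.
Qed.

End SquareSummable.

(** * Termwise limits of series with uniformly small tails *)

Section UniformTail.
Context (R : realType).
Local Notation C := (R[i]).

Lemma ccvg_normc_sub (u : nat -> C) (l : C) :
  ccvg u l -> normc (u n - l) @[n --> \oo] --> (0 : R).
Proof.
move=> ul; have -> : 0 = normc (l - l) by rewrite subrr normc0.
apply: ccvg_normc; have := ccvgD ul (ccvg_cst (- l)); exact.
Qed.

(** Cauchy-Schwarz on the terms from K to m. The factor coming from w is what W leaves beyond its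
    first K terms and does not see b, whence the uniformity. *)
Lemma sum_tail_le (a : nat -> C) (s : C) (b w : nat -> R) (B W : R) :
  (forall k, 0 <= b k) -> (forall k, 0 <= w k) ->
  (forall k, normc (a k) <= w k * b k) ->
  (forall m, \sum_(k < m) b k ^+ 2 <= B) ->
  (forall m, \sum_(k < m) w k ^+ 2 <= W) ->
  ccvg (fun m => \sum_(k < m) a k) s -> forall K,
  normc (s - \sum_(k < K) a k) <= Num.sqrt ((W - \sum_(k < K) w k ^+ 2) * B).
Proof.
move=> b0 w0 awb bB wW as_ K.
have h : ccvg (fun m => \sum_(k < m) a k - \sum_(k < K) a k) (s - \sum_(k < K) a k).
  by apply: ccvgD => //; exact: ccvg_cst.
have hn := ccvg_normc h.
rewrite -(cvg_lim _ hn)//; apply: limr_le; first by apply/cvg_ex; eexists; exact: hn.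
exists K => // m /= Km.
rewrite -(subnKC Km) big_split_ord/= addrAC subrr add0r.
apply: le_trans (normc_sum _ (fun k => a (K + k)%N)) _.
apply: (@le_trans _ _ (\sum_(k < m - K) w (K + k)%N * b (K + k)%N)).
  by apply: ler_sum => k _; exact: awb.
have n0 : 0 <= \sum_(k < m - K) w (K + k)%N * b (K + k)%N.
  by apply: sumr_ge0 => k _; rewrite mulr_ge0.
rewrite -[leLHS]ger0_norm// -sqrtr_sqr; apply: ler_wsqrtr.
apply: le_trans (@sum_cauchy_schwarz _ _ (fun k => w (K + k)%N) (fun k => b (K + k)%N)
  _ _) _ => //.
apply: ler_pM; try by apply: sumr_ge0 => k _; exact: sqr_ge0.
  have := wW (K + (m - K))%N; rewrite big_split_ord/=; lra.
have := bB (K + (m - K))%N; rewrite big_split_ord/=.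
apply: le_trans; rewrite lerDr; apply: sumr_ge0 => k _; exact: sqr_ge0.
Qed.

(* By Cauchy-Schwarz the tails of the series are small uniformly in [n]. *)
Lemma ccvg_series (a : nat -> nat -> C) (a0 : nat -> C) (s : nat -> C) (s0 : C)
    (b : nat -> nat -> R) (b0 w : nat -> R) (B M : R) :
  (forall n k, 0 <= b n k) -> (forall k, 0 <= b0 k) -> (forall k, 0 <= w k) ->
  (forall n k, normc (a n k) <= w k * b n k) ->
  (forall k, normc (a0 k) <= w k * b0 k) ->
  (forall n m, \sum_(k < m) b n k ^+ 2 <= B) ->
  (forall m, \sum_(k < m) b0 k ^+ 2 <= B) ->
  (forall m, \sum_(k < m) w k ^+ 2 <= M) ->
  (forall n, ccvg (fun m => \sum_(k < m) a n k) (s n)) ->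
  ccvg (fun m => \sum_(k < m) a0 k) s0 ->
  (forall k, ccvg (a^~ k) (a0 k)) -> ccvg s s0.
Proof.
move=> bp b0p wp ab ab0 bB b0B wM as_ as0 aa0.
pose A := series (fun k => w k ^+ 2).
have AE m : A m = \sum_(k < m) w k ^+ 2 by rewrite /A /series/= big_mkord.
have A_nd : nondecreasing_seq A by apply: nondecreasing_series => k _ _; exact: sqr_ge0.
have A_cvg : cvgn A.
  apply: (is_cvg_series_bounded (M := M)) => [k|n]; first exact: sqr_ge0.
  by rewrite -[leLHS]/(A n) AE.
have wW m : \sum_(k < m) w k ^+ 2 <= limn A.
  by rewrite -AE; exact: nondecreasing_cvgn_le.
have tail0 : Num.sqrt ((limn A - A K) * B) @[K --> \oo] --> (0 : R).
  rewrite -[X in _ --> X]sqrtr0.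
  apply: (continuous_cvg _ (@sqrt_continuous R _)).
  rewrite -(mul0r B) -(subrr (limn A)).
  apply: cvgM; last exact: cvg_cst.
  by apply: cvgB => //; exact: cvg_cst.
have est n K : normc (s n - s0) <= 2 * Num.sqrt ((limn A - A K) * B) +
    normc (\sum_(k < K) a n k - \sum_(k < K) a0 k).
  have h1 := sum_tail_le (bp n) wp (ab n) (bB n) wW (as_ n) K.
  have h2 := sum_tail_le b0p wp ab0 b0B wW as0 K.
  rewrite -AE in h1; rewrite -AE in h2.
  have -> : s n - s0 = (s n - \sum_(k < K) a n k) +
      ((\sum_(k < K) a n k - \sum_(k < K) a0 k) - (s0 - \sum_(k < K) a0 k)) by ring.
  apply: le_trans (le_normcD _ _) _.
  have := le_normcD (\sum_(k < K) a n k - \sum_(k < K) a0 k) (- (s0 - \sum_(k < K) a0 k)).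
  rewrite normcN => h3; lra.
apply: (@ccvg_bound _ _ _ (fun n => normc (s n - s0))) => //.
apply/cvgrPdist_le => e e0.
(* The cut K is fixed first, with each of the two tails at most e/4; the remaining finite sum is
   then at most e/2 for large n. *)
have e4 : 0 < e / 4 by rewrite divr_gt0.
have /cvgrPdist_le/(_ _ e4)[K _ KP] := tail0.
have := KP K (leqnn K); rewrite sub0r normrN ger0_norm ?sqrtr_ge0// => tK.
have sK : ccvg (fun n => \sum_(k < K) a n k) (\sum_(k < K) a0 k) by exact: ccvg_sum.
have e2 : 0 < e / 2 by rewrite divr_gt0.
have /cvgrPdist_le/(_ _ e2) := ccvg_normc_sub sK.
apply: filterS => n; rewrite !sub0r !normrN !ger0_norm ?normc_ge0// => nK.
have := est n K; lra.
Qed.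

End UniformTail.

(** * Weak convergence from convergence of coordinates *)

Section WeakConvergence.
Context (R : realType) (d : nat).
Local Notation C := (R[i]).
Local Notation H := (L2 R d).

(** An instance of [ccvg_series] with weights |v_k|; the bound on the sums of |x_n,k|^2 makes the
    tails uniform in n. *)
Lemma ell2_dot_weak (v : nat -> H) (x : nat -> nat -> H) (x0 : nat -> H) (B : R) :
  ell2 v -> (forall n, (ell2_sum (x n) <= B%:E)%E) -> (ell2_sum x0 <= B%:E)%E ->
  (forall k, ccvg (fun n => L2_dot (v k) (x n k)) (L2_dot (v k) (x0 k))) ->
  ccvg (fun n => ell2_dot v (x n)) (ell2_dot v x0).
Proof.
move=> vv xB x0B cx.
have fin (y : nat -> H) : (ell2_sum y <= B%:E)%E -> ell2 y.
  by move=> yB; apply: le_lt_trans yB _; rewrite ltry.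
have bnd (y : nat -> H) : (ell2_sum y <= B%:E)%E -> forall m, \sum_(k < m) L2_norm (y
  k) ^+ 2 <= B.
  move=> yB m; have h := ell2_bound (fin y yB) m.
  apply: le_trans h _.
  have f : ell2_sum y \is a fin_num.
    by rewrite ge0_fin_numE; [exact: (fin y yB)|exact: ell2_sum_ge0].
  by rewrite -lee_fin (fineK f).
apply: (@ccvg_series R (fun n k => L2_dot (v k) (x n k)) (fun k => L2_dot (v k) (x0 k))
  _ _ (fun n k => L2_norm (x n k)) (fun k => L2_norm (x0 k)) (fun k => L2_norm (v k))
  B (fine (ell2_sum v))).
- by move=> n k; exact: L2_norm_ge0.
- by move=> k; exact: L2_norm_ge0.
- by move=> k; exact: L2_norm_ge0.
- by move=> n k; exact: L2_cauchy_schwarz.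
- by move=> k; exact: L2_cauchy_schwarz.
- by move=> n; exact: (bnd (x n) (xB n)).
- exact: (bnd x0 x0B).
- exact: (ell2_bound vv).
- by move=> n; exact: (ell2_dot_cvg vv (fin (x n) (xB n))).
- exact: (ell2_dot_cvg vv (fin x0 x0B)).
- exact: cx.
Qed.

(** The same argument inside L2: Parseval writes the inner product as a series, and the weights are
    |<g, e_k>|. *)
Lemma L2_dot_weak (e : nat -> H) (g : H) (y : nat -> H) (y0 : H) (B : R) :
  orthonormal_basis e -> (forall n, L2_norm (y n) ^+ 2 <= B) -> L2_norm y0 ^+ 2 <= B ->
  (forall k, ccvg (fun n => L2_dot (e k) (y n)) (L2_dot (e k) y0)) ->
  ccvg (fun n => L2_dot g (y n)) (L2_dot g y0).
Proof.
move=> eb yB y0B cy.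
have dC (f h : H) : normc (L2_dot f h) = normc (L2_dot h f) by rewrite L2_dot_conj
  normc_conj.
have bnd (f : H) : L2_norm f ^+ 2 <= B -> forall m, \sum_(k < m) normc (L2_dot (e k) f)
  ^+ 2 <= B.
  move=> fB m; under eq_bigr do rewrite dC.
  exact: le_trans (bessel eb.1 f m) fB.
apply: (@ccvg_series R (fun n k => L2_dot g (e k) * L2_dot (e k) (y n))
  (fun k => L2_dot g (e k) * L2_dot (e k) y0) _ _
  (fun n k => normc (L2_dot (e k) (y n))) (fun k => normc (L2_dot (e k) y0))
  (fun k => normc (L2_dot g (e k))) B (L2_norm g ^+ 2)).
- by move=> n k; exact: normc_ge0.
- by move=> k; exact: normc_ge0.
- by move=> k; exact: normc_ge0.
- by move=> n k; rewrite normcM.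
- by move=> k; rewrite normcM.
- by move=> n; exact: (bnd (y n) (yB n)).
- exact: (bnd y0 y0B).
- exact: (bessel eb.1 g).
- by move=> n; exact: parseval_dot.
- exact: parseval_dot.
- by move=> k; apply: ccvgM => //; exact: ccvg_cst.
Qed.

End WeakConvergence.
Lemma normc_real (R : realType) (x : R) : normc x%:C = `|x|.
Proof. by rewrite /normc/= expr0n addr0 sqrtr_sqr. Qed.

(** * Adjoints, Hilbert-Schmidt norm and the encoding by T^* e_k *)

Section HSOperators.
Context (R : realType) (d : nat).
Local Notation C := (R[i]).
Local Notation E := (euclidean R d).
Local Notation H := (L2 R d).
Local Notation e := (@L2_basis R d).
Hypothesis e_basis : orthonormal_basis e.
Implicit Types (A B S T : H -> H) (f g : H).

Definition bounded_linear A : Prop := linear A /\ bounded_op A.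

Lemma L2_ext_dot f g : (forall h, L2_dot h f = L2_dot h g) -> f = g.
Proof.
move=> fg; apply: (L2_ext e_basis) => k.
by rewrite (L2_dot_conj (e k) f) (L2_dot_conj (e k) g) fg.
Qed.

Lemma adjointP A : bounded_linear A ->
  forall f g, L2_dot (A f) g = L2_dot f (adjoint A g).
Proof.
move=> [Al Ab]; have [B AB] := adjoint_ex e_basis Al Ab.
by rewrite (adjoint_unique AB).
Qed.

Lemma adjointPr A : bounded_linear A ->
  forall f g, L2_dot (adjoint A f) g = L2_dot f (A g).
Proof. by move=> bA f g; rewrite L2_dot_conj -(adjointP bA) -L2_dot_conj. Qed.

Lemma adjointK A : bounded_linear A -> adjoint (adjoint A) = A.
Proof. by move=> bA; apply: adjoint_unique; exact: adjointPr. Qed.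

(** The bound M of A serves its adjoint too: |A^* f|^2 = <A A^* f, f> is at most M |A^* f| |f|. *)
Lemma bounded_linear_adjoint A : bounded_linear A -> bounded_linear (adjoint A).
Proof.
move=> bA; split.
  move=> a f g; apply: L2_ext_dot => h.
  by rewrite -(adjointP bA) !L2_dotDr !L2_dotZr -!(adjointP bA).
have [_ [M AM]] := bA; exists M => f.
have [->|n0] := eqVneq (L2_norm (adjoint A f)) 0.
  exact: le_trans (L2_norm_ge0 _) (AM f).
have np : 0 < L2_norm (adjoint A f) by rewrite lt0r n0 L2_norm_ge0.
rewrite -(ler_pM2l np) -expr2.
have -> : L2_norm (adjoint A f) ^+ 2 = normc (L2_dot (A (adjoint A f)) f).
  by rewrite (adjointP bA) L2_dot_self normc_real ger0_norm ?sqr_ge0.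
apply: le_trans (L2_cauchy_schwarz _ _) _.
by rewrite mulrCA mulrA ler_wpM2r ?L2_norm_ge0.
Qed.

Lemma bounded_linear_comp A B :
  bounded_linear A -> bounded_linear B -> bounded_linear (A \o B).
Proof.
move=> [Al [M AM]] [Bl [N BN]]; split.
  by move=> a f g /=; rewrite Bl Al.
exists (`|M| * N) => f /=; apply: le_trans (AM _) _.
apply: (@le_trans _ _ (`|M| * L2_norm (B f))).
  by rewrite ler_wpM2r ?L2_norm_ge0// ler_norm.
by rewrite -mulrA ler_wpM2l.
Qed.

Lemma adjoint_comp A B : bounded_linear A -> bounded_linear B ->
  adjoint (A \o B) = adjoint B \o adjoint A.
Proof.
move=> bA bB; apply: adjoint_unique => f g /=.
by rewrite (adjointP bA) (adjointP bB).
Qed.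

Lemma bounded_linear_tf_shift (z : E * E) : bounded_linear (tf_shift z).
Proof.
split; first exact: tf_shift_lin.
by exists 1 => f; rewrite L2_norm_tf_shift mul1r.
Qed.

(** By Parseval both sides are the double sum of |<A e_k, e_j>|^2, in the two orders of
    summation. *)
Lemma ell2_sum_adjoint A : bounded_linear A ->
  ell2_sum (adjoint A \o e) = ell2_sum (A \o e).
Proof.
move=> bA; rewrite /ell2_sum.
under eq_eseriesr do rewrite -(parseval e_basis).
rewrite nneseries_interchange; last by move=> i j; rewrite lee_fin sqr_ge0.
apply: eq_eseriesr => k _; rewrite -(parseval e_basis).
apply: eq_eseriesr => j _ /=.
by rewrite (adjointPr bA) (L2_dot_conj (A (e k))) normc_conj.
Qed.

Lemma hilbert_schmidtP T : hilbert_schmidt T <-> bounded_linear T /\ ell2 (T \o e).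
Proof. by split => [[? ? ?]|[[? ?] ?]]. Qed.

Lemma ell2_adjoint T : hilbert_schmidt T -> ell2 (adjoint T \o e).
Proof. by move=> /hilbert_schmidtP[bT T2]; rewrite /ell2 ell2_sum_adjoint. Qed.

(** <T S^* e_k, e_k> = <S^* e_k, T^* e_k>: moving [T] across puts it into the second slot, so the
    two operators change places. *)
Lemma HS_dotE T S : bounded_linear T ->
  HS_dot T S = ell2_dot (adjoint S \o e) (adjoint T \o e).
Proof.
move=> bT; rewrite /HS_dot /trace /ell2_dot.
have E k : L2_dot ((T \o adjoint S) (e k)) (e k) =
    L2_dot ((adjoint S \o e) k) ((adjoint T \o e) k).
  exact: (adjointP bT (adjoint S (e k)) (e k)).
by congr (limn (series _) +i* limn (series _)); apply/funext => k; rewrite E.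
Qed.

Lemma HS_norm_sqr T : hilbert_schmidt T ->
  HS_norm T ^+ 2 = fine (ell2_sum (T \o e)).
Proof.
move=> hT; have [bT T2] := (hilbert_schmidtP T).1 hT.
rewrite /HS_norm (HS_dotE _ bT) (ell2_dot_self (ell2_adjoint hT)).
rewrite (ell2_sum_adjoint bT) -[complex.Re _]/(fine _) sqr_sqrtr//.
exact: fine_ge0 (ell2_sum_ge0 _).
Qed.

Lemma HS_norm_ge0 T : 0 <= HS_norm T. Proof. exact: sqrtr_ge0. Qed.

Lemma HS_normE T : hilbert_schmidt T -> HS_norm T = Num.sqrt (fine (ell2_sum (T \o e))).
Proof.
by move=> hT; rewrite -(HS_norm_sqr hT) sqrtr_sqr (ger0_norm (HS_norm_ge0 T)).
Qed.

(** All T e_k vanish, hence all coefficients of each T^* e_j, and then all coefficients of every T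
    f. *)
Lemma HS_norm_eq0 T : hilbert_schmidt T -> HS_norm T = 0 -> T = (fun=> 0).
Proof.
move=> hT T0; have [bT T2] := (hilbert_schmidtP T).1 hT.
have Te k : T (e k) = 0.
  apply: L2_norm_eq0; apply/eqP; rewrite -sqrf_eq0 eq_le sqr_ge0 andbT.
  have := ell2_bound T2 k.+1; rewrite -(HS_norm_sqr hT) T0 expr0n/=.
  rewrite big_ord_recr/=; apply: le_trans.
  by rewrite lerDr; apply: sumr_ge0 => j _; exact: sqr_ge0.
apply/funext => f; apply: (L2_ext e_basis) => j; rewrite (adjointP bT) L2_dot0l.
suff -> : adjoint T (e j) = 0 by rewrite L2_dot0r.
by apply: (L2_ext e_basis) => k; rewrite (adjointPr bT) Te L2_dot0r L2_dot0l.
Qed.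

(** Surjectivity of the encoding: T f is the vector whose coefficients are the <f, u_k>, which
    Cauchy-Schwarz shows to be square summable. *)
Lemma HS_exists (u : nat -> H) : ell2 u ->
  exists T, hilbert_schmidt T /\ forall k, adjoint T (e k) = u k.
Proof.
move=> u2; pose W := fine (ell2_sum u).
have bnd f n : \sum_(k < n) normc (L2_dot f (u k)) ^+ 2 <= L2_norm f ^+ 2 * W.
  apply: (@le_trans _ _ (L2_norm f ^+ 2 * \sum_(k < n) L2_norm (u k) ^+ 2)).
    rewrite mulr_sumr; apply: ler_sum => k _; rewrite -exprMn.
    apply: lerXn2r; rewrite ?nnegrE ?mulr_ge0 ?normc_ge0 ?L2_norm_ge0//.
    exact: L2_cauchy_schwarz.
  by rewrite ler_wpM2l ?sqr_ge0//; exact: ell2_bound.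
have /choice[T TP] f : exists g, forall k, L2_dot g (e k) = L2_dot f (u k).
  exact: (riesz_fischer e_basis (bnd f)).
have bT : bounded_linear T.
  split.
    move=> a f g; apply: (L2_ext e_basis) => k.
    by rewrite TP !L2_dotDl !L2_dotZl !TP.
  exists (Num.sqrt W) => f.
  have W0 : 0 <= W by exact: fine_ge0 (ell2_sum_ge0 _).
  rewrite -(@ler_pXn2r _ 2)// ?nnegrE ?mulr_ge0 ?sqrtr_ge0 ?L2_norm_ge0//.
  rewrite exprMn (sqr_sqrtr W0) [leRHS]mulrC -lee_fin -(parseval e_basis).
  apply: lime_le; first by apply: is_cvg_nneseries => k _ _; rewrite lee_fin sqr_ge0.
  apply: nearW => n; rewrite big_mkord sumEFin lee_fin.
  by under eq_bigr do rewrite TP; exact: bnd.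
have Tu k : adjoint T (e k) = u k.
  by apply: L2_ext_dot => h; rewrite -(adjointP bT) TP.
exists T; split; last exact: Tu.
apply/hilbert_schmidtP; split; first exact: bT.
rewrite /ell2 -(ell2_sum_adjoint bT).
have -> : adjoint T \o e = u by apply/funext => k; exact: Tu.
exact: u2.
Qed.

Section Cohen.
Variable S : H -> H.
Hypothesis hS : hilbert_schmidt S.

Definition tf_conj (wz : (E * E) * (E * E)) : H -> H :=
  tf_shift wz.2 \o S \o adjoint (tf_shift wz.1).

Let bS : bounded_linear S. Proof. by have [] := (hilbert_schmidtP S).1 hS. Qed.

Lemma adjoint_tf_conj wz f : adjoint (tf_conj wz) f =
  tf_shift wz.1 (adjoint S (adjoint (tf_shift wz.2) f)).
Proof.
have t1 := bounded_linear_tf_shift wz.1; have t2 := bounded_linear_tf_shift wz.2.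
have t3 := bounded_linear_adjoint t1.
rewrite /tf_conj (adjoint_comp (bounded_linear_comp t2 bS) t3).
by rewrite (adjoint_comp t2 bS) (adjointK t1).
Qed.

(** A shift applied last does not change norms. The adjoint of pi(z) S pi(w)^* ends with pi(w),
    which is dropped; taking adjoints again makes pi(z) the last factor, and it is dropped too. *)
Lemma ell2_sum_tf_conj wz :
  ell2_sum (adjoint (tf_conj wz) \o e) = ell2_sum (S \o e).
Proof.
have t2 := bounded_linear_tf_shift wz.2.
transitivity (ell2_sum (adjoint (tf_shift wz.2 \o S) \o e)).
  apply: eq_eseriesr => k _ /=.
  by rewrite adjoint_tf_conj L2_norm_tf_shift (adjoint_comp t2 bS).
rewrite (ell2_sum_adjoint (bounded_linear_comp t2 bS)).
by apply: eq_eseriesr => k _ /=; rewrite L2_norm_tf_shift.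
Qed.

Lemma cohenE T wz : bounded_linear T ->
  cohen S T wz = ell2_dot (adjoint (tf_conj wz) \o e) (adjoint T \o e).
Proof. by move=> bT; exact: HS_dotE. Qed.

Lemma ell2_tf_conj wz : ell2 (adjoint (tf_conj wz) \o e).
Proof.
rewrite /ell2 ell2_sum_tf_conj.
by have [_] := (hilbert_schmidtP S).1 hS.
Qed.

Lemma cohen_le T wz : hilbert_schmidt T ->
  normc (cohen S T wz) <= HS_norm S * HS_norm T.
Proof.
move=> hT; have [bT T2] := (hilbert_schmidtP T).1 hT.
rewrite (cohenE wz bT) (HS_normE hS) (HS_normE hT).
rewrite -(ell2_sum_tf_conj wz) -(ell2_sum_adjoint bT).
exact: (ell2_dot_le (ell2_tf_conj wz) (ell2_adjoint hT)).
Qed.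

End Cohen.
End HSOperators.
Lemma HS_norm_no_basis (R : realType) (d : nat) (T : L2 R d -> L2 R d) :
  @L2_basis R d = (fun=> 0) -> HS_norm T = 0.
Proof.
move=> e0; rewrite /HS_norm /HS_dot /trace e0.
have -> : (fun k : nat => complex.Re (L2_dot ((T \o adjoint T) 0) 0)) = (fun=> 0).
  by apply/funext => k; rewrite L2_dot0r.
have -> : series (fun=> 0 : R) = (fun=> 0).
  by apply/funext => n; rewrite /series/= big1.
by rewrite lim_cst// sqrtr0.
Qed.

(** * Compactness and maximizers *)

Lemma cmeasurable_ccvg (R : realType) dT (T : measurableType dT)
    (f : nat -> T -> R[i]) (g : T -> R[i]) :
  (forall n, cmeasurable (f n)) -> (forall x, ccvg (fun n => f n x) (g x)) ->
  cmeasurable g.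
Proof.
move=> mf fg; split.
  apply: (@measurable_fun_cvg _ _ R setT (fun n x => complex.Re (f n x))).
    by move=> n; exact: (mf n).1.
  by move=> x _; exact: (fg x).1.
apply: (@measurable_fun_cvg _ _ R setT (fun n x => complex.Im (f n x))).
  by move=> n; exact: (mf n).2.
by move=> x _; exact: (fg x).2.
Qed.

(** Tychonoff's theorem gives a cluster point l of the sequence in a product of segments; a diagonal
    choice of indices then approaches l in each coordinate. *)
Lemma cvg_extraction (R : realType) (c : nat -> nat -> R) (M : nat -> R) :
  (forall n i, `|c n i| <= M i) ->
  exists (phi : nat -> nat) (l : nat -> R), {homo phi : m n / (m < n)%N} /\
    forall i, c (phi n) i @[n --> \oo] --> l i.
Proof.
move=> cM.
have := @tychonoff nat (fun=> R) (fun i => `[- M i, M i]%classic)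
  (fun i => @segment_compact R (- M i) (M i)).
move=> /(_ (c n @[n --> \oo]) _)[|l [_ l_cl]].
  exists 0%N => // n _ /= i; have := cM n i.
  by rewrite in_itv/= ler_norml.
pose X : topologicalType := prod_topology (fun _ : nat => R).
have FX : Filter (nbhs (l : X)) by exact: nbhs_filter.
have key i r : 0 < r -> nbhs (l : X) [set f : nat -> R | `|l i - f i| < r].
  move=> r0; apply: (@proj_continuous nat (fun=> R) i l (ball (l i) r)).
  exact: nbhsx_ballx.
have nb m k : nbhs (l : X)
    [set f : nat -> R | forall i, (i < k)%N -> `|l i - f i| < m.+1%:R^-1].
  have r0 : 0 < m.+1%:R^-1 :> R by rewrite invr_gt0.
  elim: k => [|k IH]; first by apply: (@filterS _ _ FX _ _ _ filterT).
  apply: (@filterS _ _ FX _ _ _ (filterI IH (key k _ r0))) => f [f1 f2] i.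
  by rewrite ltnS leq_eqVlt => /predU1P[->//|]; exact: f1.
have pick (p : nat * nat) : exists n, (p.2 < n)%N /\
    forall i, (i < p.1)%N -> `|l i - c n i| < p.1.+1%:R^-1.
  have FA : (c n @[n --> \oo]) [set f | exists2 n, (p.2 < n)%N & f = c n].
    by exists p.2.+1 => // n /= pn; exists n.
  have [f [[n pn ->] /= h]] := l_cl _ _ FA (nb p.1 p.1).
  by exists n.
have [g gP] := choice pick.
(* At stage n = m + 1 the index exceeds [phi m] and the first n coordinates lie within 1/(n + 1) of
   l. *)
pose phi := fix F n := if n is m.+1 then g (n, F m) else g (0%N, 0%N).
exists phi, l; split.
  have phiS n : (phi n < phi n.+1)%N by exact: (gP (n.+1, phi n)).1.
  apply: homo_ltn => //; exact: ltn_trans.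
move=> i; apply/cvgrPdist_lt => r r0.
have [N _ NP] := near_infty_natSinv_lt (PosNum r0).
exists (maxn N i.+1) => // n /=; rewrite geq_max => /andP[Nn iln].
apply: lt_trans (NP n Nn).
case: n iln Nn => // n iln _.
exact: (gP (n.+1, phi n)).2.
Qed.

(** * Measurability of the Cohen class and weak compactness in S^2 *)

Section WeakCompactness.
Context (R : realType) (d : nat).
Local Notation C := (R[i]).
Local Notation E := (euclidean R d).
Local Notation H := (L2 R d).
Local Notation e := (@L2_basis R d).
Hypothesis e_basis : orthonormal_basis e.

(** Two successive expansions, of the trace and then of each of its terms, remove the adjoints of
    the shifts and leave matrix coefficients of single shifts. *)
Lemma cmeasurable_cohen (S T : H -> H) : hilbert_schmidt S -> hilbert_schmidt T ->
  cmeasurable (cohen S T).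
Proof.
move=> hS hT.
have [bS S2] := (hilbert_schmidtP S).1 hS; have [bT T2] := (hilbert_schmidtP T).1 hT.
pose g k := adjoint T (e k).
(* <pi(w) S^* pi(z)^* e_k, g> = sum_i <e_k, pi(z) S e_i> <pi(w) e_i, g> *)
apply: (@cmeasurable_ccvg R _ _ (fun n wz =>
    \sum_(k < n) L2_dot (adjoint (tf_conj S wz) (e k)) (g k))); last first.
  move=> wz; rewrite (cohenE e_basis S wz bT).
  exact: (ell2_dot_cvg (ell2_tf_conj e_basis hS wz) (ell2_adjoint e_basis hT)).
move=> n; apply: (@cmeasurable_sum R _ _ n
  (fun k wz => L2_dot (adjoint (tf_conj S wz) (e k)) (g k))) => k.
apply: (@cmeasurable_ccvg R _ _ (fun m wz =>
    \sum_(i < m) (L2_dot (tf_shift wz.2 (S (e i))) (e k))^*%C *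
      L2_dot (tf_shift wz.1 (e i)) (g k))); last first.
  move=> wz; rewrite (adjoint_tf_conj e_basis hS).
  have t1 := bounded_linear_tf_shift wz.1; have t2 := bounded_linear_tf_shift wz.2.
  rewrite (adjointP e_basis t1).
  set v := adjoint S _; set h := adjoint _ (g k).
  have -> : (fun m => \sum_(i < m) (L2_dot (tf_shift wz.2 (S (e i))) (e k))^*%C *
      L2_dot (tf_shift wz.1 (e i)) (g k)) =
      (fun m => \sum_(i < m) L2_dot v (e i) * L2_dot (e i) h).
    apply/funext => m; apply: eq_bigr => i _; congr (_ * _).
      by rewrite /v (adjointPr e_basis bS) (adjointPr e_basis t2) -L2_dot_conj.
    exact: (adjointP e_basis t1).
  exact: parseval_dot.
move=> m; apply: (@cmeasurable_sum R _ _ m (fun i wz =>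
  (L2_dot (tf_shift wz.2 (S (e i))) (e k))^*%C * L2_dot (tf_shift wz.1 (e i)) (g k))) => i.
apply: cmeasurableM.
  apply: cmeasurable_conj.
  exact: (cmeasurable_comp (cmeasurable_tf_dot (S (e i)) (e k)) measurable_snd).
exact: (cmeasurable_comp (cmeasurable_tf_dot (e i) (g k)) measurable_fst).
Qed.

(** The limits of the coefficients <e_j, T_n^* e_k> are assembled into vectors u_k by
    [riesz_fischer], and these into an operator by [HS_exists]. *)
Lemma HS_weak_compact (T_ : nat -> H -> H) :
  (forall n, hilbert_schmidt (T_ n)) -> (forall n, HS_norm (T_ n) <= 1) ->
  exists (phi : nat -> nat) (T : H -> H),
    [/\ {homo phi : m n / (m < n)%N}, hilbert_schmidt T &
      forall v, ell2 v -> ccvg (fun n => ell2_dot v (adjoint (T_ (phi n)) \o e))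
                               (ell2_dot v (adjoint T \o e))].
Proof.
move=> hT T1; pose x n k := adjoint (T_ n) (e k).
have bT n : bounded_linear (T_ n) by have [] := (hilbert_schmidtP (T_ n)).1 (hT n).
have xB n : (ell2_sum (x n) <= 1%:E)%E.
  have x2 : ell2 (x n) := ell2_adjoint e_basis (hT n).
  rewrite -(fineK (_ : ell2_sum (x n) \is a fin_num)); last first.
    by rewrite ge0_fin_numE; [exact: x2|exact: ell2_sum_ge0].
  rewrite lee_fin (ell2_sum_adjoint e_basis (bT n)) -(HS_norm_sqr e_basis (hT n)).
  by rewrite expr_le1 ?HS_norm_ge0.
have xb n K : \sum_(k < K) L2_norm (x n k) ^+ 2 <= 1.
  have x2 : ell2 (x n) := ell2_adjoint e_basis (hT n).
  apply: le_trans (ell2_bound x2 K) _; rewrite -lee_fin fineK; first exact: xB.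
  by rewrite ge0_fin_numE; [exact: x2|exact: ell2_sum_ge0].
have xk1 n k : L2_norm (x n k) ^+ 2 <= 1.
  apply: le_trans (xb n k.+1); rewrite big_ord_recr/= lerDr.
  by apply: sumr_ge0 => j _; exact: sqr_ge0.
have xk n k : L2_norm (x n k) <= 1 by rewrite -(@expr_le1 _ 2)// L2_norm_ge0.
(* The index i codes a triple (k, j, b), where b selects the real or the imaginary part; a default
   triple for indices that code nothing keeps the sequence bounded by 1. *)
pose c n i : R := let: (k, j, b) := odflt (0%N, 0%N, true) (unpickle i) in
  if b then complex.Re (L2_dot (e j) (x n k)) else complex.Im (L2_dot (e j) (x n k)).
have nx n k j : normc (L2_dot (e j) (x n k)) <= 1.
  by apply: le_trans (L2_cauchy_schwarz _ _) _; rewrite (L2_norm_basis e_basis.1) mul1r.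
have cM n i : `|c n i| <= 1.
  rewrite /c; case: (odflt _ _) => [[k j] b]; case: b; apply: le_trans (nx n k j).
    exact: Re_le_normc.
  exact: Im_le_normc.
have [phi [l [phi_lt cl]]] := cvg_extraction cM.
pose L (k j : nat) : C := l (pickle (k, j, true)) +i* l (pickle (k, j, false)).
have xL k j : ccvg (fun n => L2_dot (e j) (x (phi n) k)) (L k j).
  by split; [have := cl (pickle (k, j, true))|have := cl (pickle (k, j, false))];
    rewrite /c pickleK.
have dC (f h : H) : normc (L2_dot f h) = normc (L2_dot h f) by rewrite L2_dot_conj
  normc_conj.
(* For each n such a block is at most 1 by Bessel, and a bound on finite sums survives the limit in
   n. *)
have LB K J : \sum_(k < K) \sum_(j < J) normc (L k j) ^+ 2 <= 1.
  have h : ccvg (fun n => \sum_(k < K) \sum_(j < J)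
      L2_dot (e j) (x (phi n) k) * (L2_dot (e j) (x (phi n) k))^*%C)
      (\sum_(k < K) \sum_(j < J) L k j * (L k j)^*%C).
    apply: (@ccvg_sum R K (fun n k => \sum_(j < J)
      L2_dot (e j) (x (phi n) k) * (L2_dot (e j) (x (phi n) k))^*%C)
      (fun k => \sum_(j < J) L k j * (L k j)^*%C)) => k.
    apply: (@ccvg_sum R J (fun n j => 
      L2_dot (e j) (x (phi n) k) * (L2_dot (e j) (x (phi n) k))^*%C)
      (fun j => L k j * (L k j)^*%C)) => j.
    by apply: ccvgM; [exact: xL|apply: ccvg_conj; exact: xL].
  have rE (F : nat -> nat -> C) : complex.Re (\sum_(k < K) \sum_(j < J) F k j * (F k
    j)^*%C) =
      \sum_(k < K) \sum_(j < J) normc (F k j) ^+ 2.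
    rewrite (Re_sum _ (fun k => \sum_(j < J) F k j * (F k j)^*%C)).
    apply: eq_bigr => k _; rewrite (Re_sum _ (fun j => F k j * (F k j)^*%C)).
    by apply: eq_bigr => j _; rewrite -normc_sqrE.
  rewrite -rE -(cvg_lim _ h.1)//; apply: limr_le.
    by apply/cvg_ex; eexists; exact: h.1.
  apply: nearW => n; rewrite (rE (fun k j => L2_dot (e j) (x (phi n) k))).
  apply: le_trans (xb (phi n) K); apply: ler_sum => k _.
  under eq_bigr do rewrite dC.
  exact: (bessel e_basis.1).
(* [riesz_fischer] prescribes <u_k, e_j>, while [L k j] is a limit of numbers <e_j, .>; hence the
   conjugate. *)
have /choice[u uP] k : exists f, forall j, L2_dot f (e j) = (L k j)^*%C.
  apply: (@riesz_fischer R d e e_basis _ 1) => J.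
  under eq_bigr do rewrite normc_conj.
  apply: le_trans (LB k.+1 J); rewrite big_ord_recr/= lerDr.
  by apply: sumr_ge0 => i _; apply: sumr_ge0 => j _; exact: sqr_ge0.
have uL k j : L2_dot (e j) (u k) = L k j by rewrite L2_dot_conj uP conjcK.
(* The blocks of [LB] tend to the squared norms as J grows. *)
have ub K : \sum_(k < K) L2_norm (u k) ^+ 2 <= 1.
  have h : ccvg (fun J => \sum_(k < K) \sum_(j < J) L2_dot (u k) (e j) * L2_dot (e j) (u k))
      (\sum_(k < K) L2_dot (u k) (u k)).
    apply: (@ccvg_sum R K (fun J k => \sum_(j < J) L2_dot (u k) (e j) * L2_dot (e j) (u k))
      (fun k => L2_dot (u k) (u k))) => k.
    exact: (parseval_dot e_basis).
  have -> : \sum_(k < K) L2_norm (u k) ^+ 2 = complex.Re (\sum_(k < K) L2_dot (u k) (u k)).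
    rewrite (Re_sum _ (fun k => L2_dot (u k) (u k))).
    by apply: eq_bigr => k _; rewrite L2_norm_sqr.
  rewrite -(cvg_lim _ h.1)//; apply: limr_le.
    by apply/cvg_ex; eexists; exact: h.1.
  apply: nearW => J; apply: le_trans (LB K J).
  rewrite (Re_sum _ (fun k => \sum_(j < J) L2_dot (u k) (e j) * L2_dot (e j) (u k))).
  apply: ler_sum => k _.
  rewrite (Re_sum _ (fun j => L2_dot (u k) (e j) * L2_dot (e j) (u k))).
  by apply: ler_sum => j _; rewrite uP uL mulrC -normc_sqrE.
have uB : (ell2_sum u <= 1%:E)%E by exact: ell2_le.
have u2 : ell2 u by apply: le_lt_trans uB _; rewrite ltry.
have [T [hTT Tu]] := HS_exists e_basis u2.
exists phi, T; split => // v v2.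
have -> : adjoint T \o e = u by apply/funext => k; exact: Tu.
apply: (@ell2_dot_weak R d v (fun n => x (phi n)) u 1 v2 (fun n => xB (phi n)) uB) => k.
apply: (@L2_dot_weak R d e (v k) (fun n => x (phi n) k) (u k) 1 e_basis).
- by move=> n; exact: xk1.
- apply: le_trans (ub k.+1); rewrite big_ord_recr/= lerDr.
  by apply: sumr_ge0 => j _; exact: sqr_ge0.
- by move=> j; rewrite uL; exact: xL.
Qed.

End WeakCompactness.
(* The sign condition matters: [x `^ r] is 1, not 0, for negative [x]. *)
Lemma cvg_powR (R : realType) (u : nat -> R) (l r : R) : 0 < r ->
  (forall n, 0 <= u n) -> u n @[n --> \oo] --> l ->
  u n `^ r @[n --> \oo] --> l `^ r.
Proof.
move=> r0 u0 ul.
have l0 : 0 <= l.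
  rewrite -(cvg_lim _ ul)//; apply: limr_ge; first by apply/cvg_ex; eexists; exact: ul.
  exact: nearW.
have [lE|ln0] := eqVneq l 0; last first.
  have lp : 0 < l by rewrite lt0r ln0.
  have h : expR (r * ln (u n)) @[n --> \oo] --> expR (r * ln l).
    apply: (continuous_cvg _ (@continuous_expR R _)).
    apply: cvgM; first exact: cvg_cst.
    exact: (continuous_cvg _ (continuous_ln lp)).
  rewrite /powR (negbTE ln0); apply: cvg_trans h; apply: near_eq_cvg.
  have /cvgrPdist_lt/(_ _ lp) := ul; apply: filterS => n.
  rewrite /powR; case: eqP => // ->; rewrite subr0 ger0_norm ?ltxx//.
rewrite lE powR0 ?gt_eqF//; apply/cvgrPdist_le => eps e0.
(* The threshold which the power r maps to eps. *)
have p0 : 0 < eps `^ r^-1 by rewrite powR_gt0.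
rewrite lE in ul; have /cvgrPdist_le/(_ _ p0) := ul; apply: filterS => n.
rewrite !sub0r !normrN !ger0_norm ?powR_ge0// => h.
apply: (@le_trans _ _ ((eps `^ r^-1) `^ r)).
  by apply: ge0_ler_powR; rewrite ?nnegrE ?powR_ge0// ltW.
by rewrite -powRrM mulVf ?gt_eqF// powRr1// ltW.
Qed.

Lemma ereal_sup_seq (R : realType) (A : set (\bar R)) :
  ereal_sup A \is a fin_num ->
  exists u : nat -> \bar R, (forall n, A (u n)) /\ u n @[n --> \oo] --> ereal_sup A.
Proof.
move=> supA.
have pick (n : nat) : exists x, A x /\ (ereal_sup A - (n.+1%:R^-1)%:E < x)%E.
  have n0 : 0 < n.+1%:R^-1 :> R by rewrite invr_gt0.
  by have [x Ax xs] := ub_ereal_sup_adherent n0 supA; exists x.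
have [u uP] := choice pick; exists u; split=> [n|]; first exact: (uP n).1.
apply: (@squeeze_cvge _ _ _ _ (fun n => ereal_sup A - (n.+1%:R^-1)%:E)%E _
  (fun=> ereal_sup A)).
- apply: nearW => n; rewrite (ltW (uP n).2)/=.
  by apply: ereal_sup_ubound; exact: (uP n).1.
- rewrite -[X in _ --> X]sube0; apply: cvgeB => //.
  + by rewrite fin_num_adde_defl.
  + exact: cvg_cst.
  + by apply: cvg_EFin; [exact: nearW|exact: cvg_harmonic].
- exact: cvg_cst.
Qed.

(** * The energy on Delta and its weak continuity *)

Section Concentration.
Context (R : realType) (d : nat).
Local Notation C := (R[i]).
Local Notation E := (euclidean R d).
Local Notation H := (L2 R d).
Local Notation e := (@L2_basis R d).
Hypothesis e_basis : orthonormal_basis e.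
Variables (p : R) (Delta : set (double_phase R d)) (S : H -> H).
Hypothesis p1 : 1 <= p.
Hypothesis mDelta : measurable Delta.
Hypothesis Delta_fin : (lebesgue4 R d Delta < +oo)%E.
Hypothesis hS : hilbert_schmidt S.
Implicit Types T : H -> H.

Let p0 : 0 < p. Proof. exact: lt_le_trans p1. Qed.

(** The sigma-algebra of [double_phase] contains the product Borel sets, for which measurability of
    the Cohen class was shown. *)
Lemma measurable_double_phase (f : (E * E) * (E * E) -> R) :
  measurable_fun setT f -> measurable_fun [set: double_phase R d] (f : double_phase R d
    -> R).
Proof.
move=> mf _ Y mY; rewrite setTI.
have := mf measurableT Y mY; rewrite setTI.
exact: caratheodory_measurable_mu_ext.
Qed.

Lemma measurable_cohen_powR T : hilbert_schmidt T ->
  measurable_fun Delta (fun wz : double_phase R d => (normc (cohen S T wz) `^ p)%:E).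
Proof.
move=> hT; apply: measurable_funTS; apply/measurable_EFinP.
apply: (measurableT_comp (measurable_powR p)).
apply: measurable_double_phase.
exact: (measurable_normc (cmeasurable_cohen e_basis hS hT)).
Qed.

Definition energy T : \bar R :=
  (\int[lebesgue4 R d]_(wz in Delta) (normc (cohen S T wz) `^ p)%:E)%E.

Lemma energy_ge0 T : (0 <= energy T)%E.
Proof. by apply: integral_ge0 => wz _; rewrite lee_fin powR_ge0. Qed.

Lemma cohen_powR_le T wz : hilbert_schmidt T ->
  normc (cohen S T wz) `^ p <= (HS_norm S * HS_norm T) `^ p.
Proof.
move=> hT; apply: ge0_ler_powR.
- exact: ltW.
- by rewrite nnegrE normc_ge0.
- by rewrite nnegrE mulr_ge0// HS_norm_ge0.
- exact: cohen_le.
Qed.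

Lemma energy_le T : hilbert_schmidt T ->
  (energy T <= ((HS_norm S * HS_norm T) `^ p)%:E * lebesgue4 R d Delta)%E.
Proof.
move=> hT; rewrite -(integral_cst (lebesgue4 R d) mDelta).
apply: ge0_le_integral.
- exact: mDelta.
- by move=> wz _; rewrite lee_fin powR_ge0.
- exact: measurable_cohen_powR.
- exact: measurable_cst.
- by move=> wz _; rewrite lee_fin; exact: cohen_powR_le.
Qed.

Lemma energy_fin T : hilbert_schmidt T -> energy T \is a fin_num.
Proof.
move=> hT; rewrite ge0_fin_numE; last exact: energy_ge0.
apply: le_lt_trans (energy_le hT) _.
by apply: lte_mul_pinfty => //; rewrite lee_fin powR_ge0.
Qed.

Lemma concentrationE T : hilbert_schmidt T ->
  concentration p Delta S T = (fine (energy T) `^ p^-1 / HS_norm T)%:E.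
Proof.
move=> hT; rewrite /concentration -/(energy T) -{1}(fineK (energy_fin hT)).
by rewrite poweR_EFin.
Qed.

Lemma energy_cvg (T_ : nat -> H -> H) T : (forall n, hilbert_schmidt (T_ n)) ->
  (forall n, HS_norm (T_ n) <= 1) -> hilbert_schmidt T ->
  (forall v, ell2 v -> ccvg (fun n => ell2_dot v (adjoint (T_ n) \o e))
                            (ell2_dot v (adjoint T \o e))) ->
  fine (energy (T_ n)) @[n --> \oo] --> fine (energy T).
Proof.
move=> hT_ T_1 hT weak.
have bT_ n : bounded_linear (T_ n) by have [] := (hilbert_schmidtP (T_ n)).1 (hT_ n).
have bT : bounded_linear T by have [] := (hilbert_schmidtP T).1 hT.
apply: fine_cvg; rewrite fineK; last exact: energy_fin.
have ff : {ae lebesgue4 R d, forall wz, Delta wz ->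
    (normc (cohen S (T_ n) wz) `^ p)%:E @[n --> \oo] -->
    (normc (cohen S T wz) `^ p)%:E}.
  apply: nearW => wz _; apply: cvg_EFin; first exact: nearW.
  apply: (cvg_powR p0 (fun n => normc_ge0 _)).
  apply: ccvg_normc; rewrite (cohenE e_basis S wz bT).
  have -> : (fun n => cohen S (T_ n) wz) =
      (fun n => ell2_dot (adjoint (tf_conj S wz) \o e) (adjoint (T_ n) \o e)).
    by apply/funext => n; exact: (cohenE e_basis S wz (bT_ n)).
  exact: (weak _ (ell2_tf_conj e_basis hS wz)).
have ig : (lebesgue4 R d).-integrable Delta (fun=> (HS_norm S `^ p)%:E).
  apply/integrableP; split; first exact: measurable_cst.
  rewrite (integral_cst (lebesgue4 R d) mDelta); apply: lte_mul_pinfty => //.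
have fg : {ae lebesgue4 R d, forall wz n, Delta wz ->
    (`|(normc (cohen S (T_ n) wz) `^ p)%:E| <= (HS_norm S `^ p)%:E)%E}.
  apply: nearW => wz n _.
  rewrite gee0_abs; last by rewrite lee_fin powR_ge0.
  rewrite lee_fin; apply: le_trans (cohen_powR_le wz (hT_ n)) _.
  apply: ge0_ler_powR.
  - exact: ltW.
  - by rewrite nnegrE mulr_ge0// HS_norm_ge0.
  - by rewrite nnegrE HS_norm_ge0.
  - by rewrite ler_piMr ?HS_norm_ge0.
have [_ _ h] := dominated_convergence mDelta
  (fun n => measurable_cohen_powR (hT_ n)) (measurable_cohen_powR hT) ff ig fg.
exact: h.
Qed.

End Concentration.
Local Opaque L2_norm adjoint HS_norm ell2_dot cohen.
Section Ell2Sub.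
Context (R : realType) (d : nat).
Variables x y : nat -> L2 R d.
Hypotheses (x2 : ell2 x) (y2 : ell2 y).

Let normB k : L2_norm (x k - y k) ^+ 2 = L2_norm (x k) ^+ 2 -
  2 * complex.Re (L2_dot (y k) (x k)) + L2_norm (y k) ^+ 2.
Proof.
rewrite L2_normD_sqr L2_normN (L2_dot_conj (- y k)) L2_dotNl ReJ; congr (_ + _ + _).
by rewrite -mulrN; case: (L2_dot _ _).
Qed.

Lemma ell2B : ell2 (fun k => x k - y k).
Proof.
apply: (@le_lt_trans _ _ (2 * fine (ell2_sum x) + 2 * fine (ell2_sum y))%:E);
  last by rewrite ltry.
apply: ell2_le => n.
apply: (@le_trans _ _ (2 * (\sum_(k < n) L2_norm (x k) ^+ 2) +
    2 * (\sum_(k < n) L2_norm (y k) ^+ 2))).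
  rewrite !mulr_sumr -big_split/=; apply: ler_sum => k _.
  have := L2_normD (x k) (- y k); rewrite L2_normN.
  have := L2_norm_ge0 (x k - y k).
  have := sqr_ge0 (L2_norm (x k) - L2_norm (y k)).
  move: (L2_norm (x k)) (L2_norm (y k)) (L2_norm (x k - y k)) => a b c h c0 cab.
  apply: (@le_trans _ _ ((a + b) ^+ 2)); last by nra.
  by apply: lerXn2r => //; rewrite nnegrE// (le_trans c0).
by apply: lerD; rewrite ler_pM2l//; exact: ell2_bound.
Qed.

Lemma ell2_sumB : fine (ell2_sum (fun k => x k - y k)) =
  fine (ell2_sum x) - 2 * complex.Re (ell2_dot y x) + fine (ell2_sum y).
Proof.
apply: (cvg_unique _ (ell2_cvg ell2B)) => //.
have -> : (fun n => \sum_(k < n) L2_norm (x k - y k) ^+ 2) =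
    (fun n => \sum_(k < n) L2_norm (x k) ^+ 2 -
      2 * complex.Re (\sum_(k < n) L2_dot (y k) (x k)) +
      \sum_(k < n) L2_norm (y k) ^+ 2).
  apply/funext => n.
  under eq_bigr do rewrite normB.
  rewrite (Re_sum _ (fun k => L2_dot (y k) (x k))).
  by rewrite big_split/= sumrB/= -mulr_sumr.
apply: cvgD (ell2_cvg y2); apply: cvgB (ell2_cvg x2) _.
by apply: cvgM; [exact: cvg_cst|exact: (ell2_dot_cvg y2 x2).1].
Qed.

End Ell2Sub.

(** * Differences, multiples and rank-one operators *)

Section HSGeometry.
Context (R : realType) (d : nat).
Local Notation C := (R[i]).
Local Notation E := (euclidean R d).
Local Notation H := (L2 R d).
Local Notation e := (@L2_basis R d).
Hypothesis e_basis : orthonormal_basis e.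
Implicit Types A B S T : H -> H.

Lemma adjoint_sub A B : bounded_linear A -> bounded_linear B ->
  adjoint (A \- B) = adjoint A \- adjoint B.
Proof.
move=> bA bB; apply: adjoint_unique => f g.
rewrite /= L2_dotBl (adjointP e_basis bA) (adjointP e_basis bB).
by rewrite L2_dotBr.
Qed.

Lemma bounded_linear_sub A B : bounded_linear A -> bounded_linear B ->
  bounded_linear (A \- B).
Proof.
move=> [Al [M AM]] [Bl [N BN]]; split.
  by move=> a f g /=; rewrite Al Bl scalerBr opprD addrACA.
exists (M + N) => f /=; apply: le_trans (L2_normD _ _) _.
by rewrite L2_normN mulrDl lerD.
Qed.

Lemma hilbert_schmidt_sub A B :
  hilbert_schmidt A -> hilbert_schmidt B -> hilbert_schmidt (A \- B).
Proof.
move=> /hilbert_schmidtP[bA A2] /hilbert_schmidtP[bB B2].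
apply/hilbert_schmidtP; split; first exact: bounded_linear_sub.
exact: (ell2B A2 B2).
Qed.

Lemma HS_normB_sqr A B : hilbert_schmidt A -> hilbert_schmidt B ->
  HS_norm (A \- B) ^+ 2 = HS_norm A ^+ 2 -
    2 * complex.Re (ell2_dot (adjoint B \o e) (adjoint A \o e)) + HS_norm B ^+ 2.
Proof.
move=> hA hB; have hAB := hilbert_schmidt_sub hA hB.
have key T : hilbert_schmidt T -> HS_norm T ^+ 2 = fine (ell2_sum (adjoint T \o e)).
  move=> hT; have [bT _] := (hilbert_schmidtP T).1 hT.
  by rewrite (ell2_sum_adjoint e_basis bT); exact: HS_norm_sqr.
have [bA _] := (hilbert_schmidtP A).1 hA; have [bB _] := (hilbert_schmidtP B).1 hB.
apply: (etrans (key _ hAB)); rewrite (adjoint_sub bA bB).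
apply: (etrans (ell2_sumB (ell2_adjoint e_basis hA) (ell2_adjoint e_basis hB))).
by congr (_ - _ + _); [exact: (esym (key _ hA))|exact: (esym (key _ hB))].
Qed.

Lemma ell2_dot_adjoint_le A B : hilbert_schmidt A -> hilbert_schmidt B ->
  normc (ell2_dot (adjoint A \o e) (adjoint B \o e)) <= HS_norm A * HS_norm B.
Proof.
move=> hA hB.
have key T : hilbert_schmidt T ->
    Num.sqrt (fine (ell2_sum (adjoint T \o e))) = HS_norm T.
  move=> hT; have [bT _] := (hilbert_schmidtP T).1 hT.
  by rewrite (ell2_sum_adjoint e_basis bT); exact: (esym (HS_normE e_basis hT)).
apply: le_trans (ell2_dot_le (ell2_adjoint e_basis hA) (ell2_adjoint e_basis hB)) _.
rewrite le_eqVlt; apply/orP; left; apply/eqP.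
by congr (_ * _); [exact: (key A hA)|exact: (key B hB)].
Qed.

(** Real scalars suffice, the purpose being to normalize the Hilbert-Schmidt norm. *)
Definition scale_op (a : R) T : H -> H := fun f => a%:C *: T f.

Lemma bounded_linear_scale a T : bounded_linear T -> bounded_linear (scale_op a T).
Proof.
move=> [Tl [M TM]]; split.
  by move=> b f g; rewrite /scale_op Tl scalerDr !scalerA mulrC.
exists (`|a| * M) => f; rewrite /scale_op L2_normZ normc_real -mulrA.
by rewrite ler_wpM2l.
Qed.

Lemma adjoint_scale a T : bounded_linear T ->
  adjoint (scale_op a T) = scale_op a (adjoint T).
Proof.
move=> bT; apply: adjoint_unique => f g; rewrite /scale_op.
by rewrite L2_dotZl L2_dotZr conjc_real (adjointP e_basis bT).
Qed.

Lemma ell2_sum_scale (a : R) (x : nat -> H) :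
  ell2_sum (fun k => a%:C *: x k) = ((a ^+ 2)%:E * ell2_sum x)%E.
Proof.
rewrite /ell2_sum -nneseriesZl; last by move=> k _; rewrite lee_fin sqr_ge0.
apply: eq_eseriesr => k _; rewrite L2_normZ normc_real exprMn.
by rewrite real_normK ?num_real// EFinM.
Qed.

Lemma hilbert_schmidt_scale a T : hilbert_schmidt T -> hilbert_schmidt (scale_op a T).
Proof.
move=> /hilbert_schmidtP[bT T2]; apply/hilbert_schmidtP; split.
  exact: bounded_linear_scale.
rewrite /ell2 (ell2_sum_scale a (T \o e)); apply: lte_mul_pinfty => //.
by rewrite lee_fin sqr_ge0.
Qed.

Lemma HS_norm_scale a T : hilbert_schmidt T ->
  HS_norm (scale_op a T) = `|a| * HS_norm T.
Proof.
move=> hT; have [bT T2] := (hilbert_schmidtP T).1 hT.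
rewrite (HS_normE e_basis (hilbert_schmidt_scale a hT)) (HS_normE e_basis hT).
rewrite (ell2_sum_scale a (T \o e)) fineM//; last first.
  by rewrite ge0_fin_numE; [exact: T2|exact: ell2_sum_ge0].
by rewrite sqrtrM ?sqr_ge0// sqrtr_sqr.
Qed.

Lemma cohen_scale a S T wz : hilbert_schmidt S -> hilbert_schmidt T ->
  cohen S (scale_op a T) wz = a%:C * cohen S T wz.
Proof.
move=> hS hT; have [bT T2] := (hilbert_schmidtP T).1 hT.
rewrite (cohenE e_basis S wz bT) (cohenE e_basis S wz (bounded_linear_scale a bT)).
apply: ell2_dot_eq; rewrite (adjoint_scale a bT).
have := ccvgM (ccvg_cst a%:C)
  (ell2_dot_cvg (ell2_tf_conj e_basis hS wz) (ell2_adjoint e_basis hT)).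
congr (ccvg _ _); apply/funext => n; rewrite mulr_sumr; apply: eq_bigr => k _.
by rewrite /= /scale_op L2_dotZr conjc_real.
Qed.

(** The code of the rank-one operator that sends h to <h, f> e_k. *)
Lemma ell2_single (k : nat) (f : H) : ell2 (fun i => if i == k then f else 0).
Proof.
apply: (@le_lt_trans _ _ (L2_norm f ^+ 2)%:E); last by rewrite ltry.
apply: ell2_le => n.
apply: (@le_trans _ _ ((k < n)%:R * L2_norm f ^+ 2)).
  elim: n => [|n IH]; first by rewrite big_ord0 mul0r.
  rewrite big_ord_recr/= ltnS leq_eqVlt [n == k]eq_sym.
  case: (eqVneq k n) IH => [->|_] IH /=; last by rewrite L2_norm0 expr0n addr0.
  by move: IH; rewrite ltnn mul0r mul1r => IH; rewrite gerDr.
by case: (k < n)%N; rewrite ?mul1r// mul0r sqr_ge0.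
Qed.

Lemma ell2_dot_single (v : nat -> H) (k : nat) (f : H) :
  ell2_dot v (fun i => if i == k then f else 0) = L2_dot (v k) f.
Proof.
apply: ell2_dot_eq.
have E n : (k < n)%N ->
    \sum_(i < n) L2_dot (v i) (if i == k :> nat then f else 0) = L2_dot (v k) f.
  move=> kn; rewrite (bigD1 (Ordinal kn))//= eqxx big1 ?addr0// => i.
  by rewrite -val_eqE/= => /negbTE ->; rewrite L2_dot0r.
by split; apply: cvg_near_cst; exists k.+1 => // n kn; rewrite (E n kn).
Qed.

End HSGeometry.

(** * Maximizing sequences and existence of maximizers *)

Section Maximizers.
Context (R : realType) (d : nat).
Local Notation C := (R[i]).
Local Notation E := (euclidean R d).
Local Notation H := (L2 R d).
Local Notation e := (@L2_basis R d).
Hypothesis e_basis : orthonormal_basis e.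
Variables (p : R) (Delta : set (double_phase R d)) (S : H -> H).
Hypothesis p1 : 1 <= p.
Hypothesis mDelta : measurable Delta.
Hypothesis Delta_gt0 : (0 < lebesgue4 R d Delta)%E.
Hypothesis Delta_fin : (lebesgue4 R d Delta < +oo)%E.
Hypothesis hS : hilbert_schmidt S.
Implicit Types T : H -> H.

Let p0 : 0 < p. Proof. exact: lt_le_trans p1. Qed.
Let pV0 : 0 < p^-1. Proof. by rewrite invr_gt0. Qed.

Local Notation En := (energy p Delta S).

Lemma energy_eq0 T : hilbert_schmidt T -> En T = 0%E ->
  {ae lebesgue4 R d, forall wz, Delta wz -> cohen S T wz = 0}.
Proof.
move=> hT E0; have m := @measurable_cohen_powR R d e_basis p Delta S hS T hT.
have pos (wz : double_phase R d) : (`|(normc (cohen S T wz) `^ p)%:E| =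
    (normc (cohen S T wz) `^ p)%:E)%E by rewrite gee0_abs// lee_fin powR_ge0.
have : (\int[lebesgue4 R d]_(wz in Delta) `|(normc (cohen S T wz) `^ p)%:E| = 0)%E.
  by under eq_integral do rewrite pos; exact: E0.
move=> /(ae_eq_integral_abs (lebesgue4 R d) mDelta m).
apply: filterS => wz h Dwz; have := h Dwz => /= -[] /powR_eq0_eq0.
exact: eq0_normc.
Qed.

Lemma energy_gt0 : S <> (fun=> 0) -> exists T, hilbert_schmidt T /\ (0 < En T)%E.
Proof.
move=> Sn0; apply: contrapT => noT; apply: Sn0.
have E0 T : hilbert_schmidt T -> En T = 0%E.
  move=> hT; apply/eqP; rewrite eq_le energy_ge0 andbT leNgt; apply/negP => ET.
  by apply: noT; exists T.
(* [T (k, j)] sends h to <h, e_j> e_k, so its Cohen class is the (k, j) coefficient of the adjoint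
   of pi(z) S pi(w)^*. *)
have /choice[T TP] (kj : nat * nat) : exists T, hilbert_schmidt T /\
    forall i, adjoint T (e i) = if i == kj.1 then e kj.2 else 0.
  exact: (HS_exists e_basis (ell2_single kj.1 (e kj.2))).
have TE k j wz : cohen S (T (k, j)) wz = L2_dot (adjoint (tf_conj S wz) (e k)) (e j).
  have [hT Te] := TP (k, j); have [bT _] := (hilbert_schmidtP _).1 hT.
  rewrite (cohenE e_basis S wz bT).
  have -> : adjoint (T (k, j)) \o e = fun i => if i == k then e j else 0.
    by apply/funext => i; exact: Te.
  exact: ell2_dot_single.
(* The countably many null sets are merged into one, so that a single point of [Delta], which has
   positive measure, serves all pairs (k, j). *)
have : {ae lebesgue4 R d, forall (wz : double_phase R d) k j, Delta wz ->
    L2_dot (adjoint (tf_conj S wz) (e k)) (e j) = 0}.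
  apply: ae_foralln => k; apply: ae_foralln => j.
  have [hT _] := TP (k, j); have := energy_eq0 hT (E0 _ hT).
  by apply: filterS => wz h Dwz; rewrite -TE; exact: h.
move=> [N [mN N0 subN]].
have [wz [Dwz Nwz]] : exists wz, Delta wz /\ ~ N wz.
  apply: contrapT => noz; have : (lebesgue4 R d Delta <= lebesgue4 R d N)%E.
    apply: le_measure; rewrite ?inE// => wz Dwz.
    by apply: contrapT => Nwz; apply: noz; exists wz.
  by rewrite N0 leNgt Delta_gt0.
have M0 k : adjoint (tf_conj S wz) (e k) = 0.
  apply: (L2_ext e_basis) => j; rewrite L2_dot0l.
  apply: contrapT => ne0; apply: Nwz; apply: subN => /= h.
  exact: ne0 (h k j Dwz).
apply: (HS_norm_eq0 e_basis hS).
rewrite (HS_normE e_basis hS) -(ell2_sum_tf_conj e_basis hS wz) /ell2_sum.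
rewrite eseries0; first by rewrite sqrtr0.
by move=> k _ _ /=; rewrite M0 L2_norm0 expr0n.
Qed.

Lemma concentration_ge0 T : (0 <= concentration p Delta S T)%E.
Proof.
rewrite /concentration mule_ge0 ?poweR_ge0//.
by rewrite lee_fin invr_ge0 HS_norm_ge0.
Qed.

Lemma HS_norm_gt0 T : hilbert_schmidt T -> T <> (fun=> 0) -> 0 < HS_norm T.
Proof.
move=> hT Tn0; rewrite lt0r HS_norm_ge0 andbT; apply/eqP => T0.
exact: Tn0 (HS_norm_eq0 e_basis hT T0).
Qed.

Lemma HS_norm0 : HS_norm (fun=> 0 : H) = 0.
Proof.
have bz : bounded_linear (fun=> 0 : H).
  by split=> [a f g|]; [rewrite scaler0 addr0|exists 0 => f; rewrite L2_norm0 mul0r].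
have z0 : ell2_sum ((fun=> 0 : H) \o e) = 0%E.
  by rewrite /ell2_sum eseries0// => k _ _ /=; rewrite L2_norm0 expr0n.
have hz : hilbert_schmidt (fun=> 0 : H).
  by apply/hilbert_schmidtP; split; [exact: bz|rewrite /ell2 z0 ltry].
by rewrite (HS_normE e_basis hz) z0 sqrtr0.
Qed.

Lemma concentration_le_max T : hilbert_schmidt T -> T <> (fun=> 0) ->
  (concentration p Delta S T <= max_concentration p Delta S)%E.
Proof. by move=> hT Tn0; apply: ereal_sup_ubound; exists T. Qed.

Lemma energy_gt0_neq0 T : hilbert_schmidt T -> (0 < En T)%E -> T <> (fun=> 0).
Proof.
move=> hT ET TE; move: ET; apply/negP; rewrite -leNgt.
apply: le_trans (energy_le e_basis p1 mDelta hS hT) _.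
by rewrite TE HS_norm0 mulr0 powR0 ?gt_eqF// mul0e.
Qed.

Lemma energy_scale a T : hilbert_schmidt T -> 0 <= a ->
  En (scale_op a T) = ((a `^ p)%:E * En T)%E.
Proof.
move=> hT a0; have m := @measurable_cohen_powR R d e_basis p Delta S hS T hT.
have pos (wz : double_phase R d) : Delta wz -> (0 <= (normc (cohen S T wz) `^ p)%:E)%E.
  by move=> _; rewrite lee_fin powR_ge0.
have ap : (0 <= (a `^ p)%:E)%E by rewrite lee_fin powR_ge0.
rewrite /energy -(ge0_integralZl (lebesgue4 R d) mDelta m pos ap).
apply: eq_integral => wz _; rewrite (cohen_scale e_basis a wz hS hT).
by rewrite normcM normc_real (ger0_norm a0) powRM ?normc_ge0// EFinM.
Qed.

(** The energy is homogeneous of degree p, so its p-th root and the norm scale by the same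
    factor. *)
Lemma normalize_concentration T : hilbert_schmidt T -> T <> (fun=> 0) ->
  exists T', [/\ hilbert_schmidt T', HS_norm T' = 1 &
    concentration p Delta S T' = concentration p Delta S T].
Proof.
move=> hT Tn0; have Tp := HS_norm_gt0 hT Tn0.
have a0 : 0 <= (HS_norm T)^-1 by rewrite invr_ge0 ltW.
have hT' := hilbert_schmidt_scale (HS_norm T)^-1 hT.
have n1 : HS_norm (scale_op (HS_norm T)^-1 T) = 1.
  by rewrite (HS_norm_scale e_basis _ hT) (ger0_norm a0) mulVf// gt_eqF.
exists (scale_op (HS_norm T)^-1 T); split; [exact: hT'|exact: n1|].
rewrite (concentrationE e_basis p1 mDelta Delta_fin hS hT').
rewrite (concentrationE e_basis p1 mDelta Delta_fin hS hT) n1 (energy_scale hT a0).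
have fE := energy_fin e_basis p1 mDelta Delta_fin hS hT.
rewrite fineM// powRM ?powR_ge0 ?fine_ge0 ?energy_ge0//.
by rewrite -powRrM mulfV ?gt_eqF// powRr1// divr1 mulrC.
Qed.

(** An operator of positive energy shows that the supremum is not that of the empty set; on
    normalized operators the quotient is at most the p-th root of |S|^p |Delta|. *)
Lemma max_concentration_fin : S <> (fun=> 0) -> max_concentration p Delta S \is a fin_num.
Proof.
move=> Sn0; have [T0 [hT0 ET0]] := energy_gt0 Sn0.
have T0n0 := energy_gt0_neq0 hT0 ET0.
rewrite ge0_fin_numE; last first.
  exact: le_trans (concentration_ge0 T0) (concentration_le_max hT0 T0n0).
pose B := ((HS_norm S `^ p)%:E * lebesgue4 R d Delta)%E.
apply: (@le_lt_trans _ _ (fine B `^ p^-1)%:E); last by rewrite ltry.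
apply: ge_ereal_sup => _ [T [hT Tn0] <-].
have [T' [hT' n1 <-]] := normalize_concentration hT Tn0.
rewrite (concentrationE e_basis p1 mDelta Delta_fin hS hT') n1 divr1 lee_fin.
have := energy_le e_basis p1 mDelta hS hT'; rewrite n1 mulr1 -/B => EB.
have Bf : B \is a fin_num.
  rewrite ge0_fin_numE; first by apply: lte_mul_pinfty => //; rewrite lee_fin powR_ge0.
  by apply: mule_ge0; [rewrite lee_fin powR_ge0|exact: measure_ge0].
apply: ge0_ler_powR.
- exact: ltW.
- rewrite nnegrE; exact: fine_ge0 (energy_ge0 _ _ _ _).
- rewrite nnegrE; apply: fine_ge0; exact: le_trans (energy_ge0 _ _ _ _) EB.
- exact: fine_le (energy_fin e_basis p1 mDelta Delta_fin hS hT') Bf EB.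
Qed.

Lemma maximizing_subsequence (T_ : nat -> H -> H) : S <> (fun=> 0) ->
  (forall n, hilbert_schmidt (T_ n)) -> (forall n, HS_norm (T_ n) = 1) ->
  concentration p Delta S (T_ n) @[n --> \oo] --> max_concentration p Delta S ->
  exists (phi : nat -> nat) (T : H -> H),
    [/\ {homo phi : m n / (m < n)%N}, maximizer p Delta S T &
        HS_norm (T_ (phi n) \- T) @[n --> \oo] --> (0 : R)].
Proof.
move=> Sn0 hT_ T_1 T_max.
have T_le1 n : HS_norm (T_ n) <= 1 by rewrite T_1.
have [phi [T [phi_lt hT weak]]] := HS_weak_compact e_basis hT_ T_le1.
exists phi, T.
have [bT T2] := (hilbert_schmidtP T).1 hT.
pose F := fine (En T).
have ecvg : fine (En (T_ (phi n))) @[n --> \oo] --> F := energy_cvg e_basis p1 mDelta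
  Delta_fin hS (fun n => hT_ (phi n))
  (fun n => T_le1 (phi n)) hT weak.
have F0 : 0 <= F by exact: fine_ge0 (energy_ge0 _ _ _ _).
have phioo : phi n @[n --> \oo] --> \oo.
  have phi_ge n : (n <= phi n)%N.
    by elim: n => // n IH; apply: leq_ltn_trans IH _; exact: phi_lt.
  by move=> A [N _ NA]; exists N => // n /= Nn; apply: NA => /=;
    exact: leq_trans (phi_ge n).
have maxE : max_concentration p Delta S = (F `^ p^-1)%:E.
  have c1 : concentration p Delta S (T_ (phi n)) @[n --> \oo] --> max_concentration p
    Delta S.
    exact: (cvg_comp _ _ phioo T_max).
  have c2 : concentration p Delta S (T_ (phi n)) @[n --> \oo] --> (F `^ p^-1)%:E.
    have -> : (fun n => concentration p Delta S (T_ (phi n))) =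
        (fun n => (fine (En (T_ (phi n))) `^ p^-1)%:E).
      apply/funext => n; rewrite (concentrationE e_basis p1 mDelta Delta_fin hS (hT_ _)).
      by rewrite T_1 divr1.
    apply: cvg_EFin; first exact: nearW.
    apply: (cvg_powR pV0 _ ecvg) => n.
    exact: fine_ge0 (energy_ge0 _ _ _ _).
  exact: (cvg_unique _ c1 c2).
have Fp : 0 < F `^ p^-1.
  have [T0 [hT0 ET0]] := energy_gt0 Sn0.
  have T0n0 := energy_gt0_neq0 hT0 ET0.
  have := concentration_le_max hT0 T0n0.
  rewrite maxE (concentrationE e_basis p1 mDelta Delta_fin hS hT0) lee_fin.
  apply: lt_le_trans; apply: divr_gt0; last exact: HS_norm_gt0.
  by apply: powR_gt0; rewrite fine_gt0// ET0 ltey_eq (energy_fin e_basis p1 mDelta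
    Delta_fin hS hT0).
have Tn0 : T <> (fun=> 0).
  move=> TE; have := energy_le e_basis p1 mDelta hS hT.
  rewrite {2}TE HS_norm0 mulr0 powR0 ?gt_eqF// mul0e => ET.
  have F00 : F = 0.
    by rewrite /F (_ : En T = 0%E)//; apply/eqP; rewrite eq_le ET energy_ge0.
  by move: Fp; rewrite F00 powR0 ?gt_eqF// ltxx.
have Tp := HS_norm_gt0 hT Tn0.
(* The quotient of [T] is the positive maximum divided by |T|, and it cannot exceed the maximum. *)
have T_ge1 : 1 <= HS_norm T.
  have := concentration_le_max hT Tn0.
  rewrite maxE (concentrationE e_basis p1 mDelta Delta_fin hS hT) lee_fin.
  by rewrite ler_pdivrMr// ler_pMr.
have x2 := ell2_adjoint e_basis hT.
have wT := weak _ x2.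
have sT : ell2_dot (adjoint T \o e) (adjoint T \o e) = (HS_norm T ^+ 2)%:C.
  rewrite (ell2_dot_self x2); congr (_%:C).
  by rewrite (ell2_sum_adjoint e_basis bT); exact: (esym (HS_norm_sqr e_basis hT)).
(* Weak convergence is tested against [T] itself: |T|^2 is the limit of numbers that are at most |T|
   by Cauchy-Schwarz. *)
have T_le : HS_norm T <= 1.
  rewrite -(ler_pM2l Tp) mulr1 -expr2.
  have h := wT.1; rewrite sT in h.
  rewrite -[HS_norm T ^+ 2]/(complex.Re (HS_norm T ^+ 2)%:C) -(cvg_lim _ h)//.
  apply: limr_le; first by apply/cvg_ex; eexists; exact: h.
  apply: nearW => n; apply: le_trans (ler_norm _) _; apply: le_trans (Re_le_normc _) _.
  apply: le_trans (ell2_dot_adjoint_le e_basis hT (hT_ (phi n))) _.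
  by rewrite T_1 mulr1.
have T1 : HS_norm T = 1 by apply/eqP; rewrite eq_le T_le T_ge1.
split; [exact: phi_lt| |].
  split; [exact: hT|exact: Tn0|].
  by rewrite (concentrationE e_basis p1 mDelta Delta_fin hS hT) T1 divr1 maxE.
have sq : HS_norm (T_ (phi n) \- T) ^+ 2 @[n --> \oo] --> (0 : R).
  have -> : (fun n => HS_norm (T_ (phi n) \- T) ^+ 2) =
      (fun n => 1 - 2 * complex.Re (ell2_dot (adjoint T \o e) (adjoint (T_ (phi n)) \o
        e)) + 1).
    apply/funext => n; rewrite (HS_normB_sqr e_basis (hT_ (phi n)) hT).
    by rewrite T_1 T1 expr1n.
  have -> : (0 : R) = 1 - 2 * 1 + 1 by ring.
  apply: cvgD; last exact: cvg_cst.
  apply: cvgB; first exact: cvg_cst.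
  apply: cvgM; first exact: cvg_cst.
  by have := wT.1; rewrite sT T1 expr1n.
have h : (fun n => Num.sqrt (HS_norm (T_ (phi n) \- T) ^+ 2)) n @[n --> \oo] -->
    Num.sqrt (0 : R) by exact: (continuous_cvg _ (@sqrt_continuous R _) sq).
have E n : Num.sqrt (HS_norm (T_ (phi n) \- T) ^+ 2) = HS_norm (T_ (phi n) \- T).
  by rewrite sqrtr_sqr; exact: ger0_norm (HS_norm_ge0 _).
by rewrite sqrtr0 in h; under eq_fun do rewrite -E.
Qed.

Lemma maximizer_exists : S <> (fun=> 0) -> exists T, maximizer p Delta S T.
Proof.
move=> Sn0.
have [u [uA u_max]] := ereal_sup_seq (max_concentration_fin Sn0).
have /choice[T_ T_P] n : exists T', [/\ hilbert_schmidt T', HS_norm T' = 1 &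
    concentration p Delta S T' = u n].
  have [T [hT Tn0] <-] := uA n.
  exact: normalize_concentration.
have h1 n : hilbert_schmidt (T_ n) by have [] := T_P n.
have h2 n : HS_norm (T_ n) = 1 by have [] := T_P n.
have h3 : concentration p Delta S (T_ n) @[n --> \oo] --> max_concentration p Delta S.
  have -> // : (fun n => concentration p Delta S (T_ n)) = u.
  by apply/funext => n; have [] := T_P n.
by have [phi [T [_ TM _]]] := maximizing_subsequence Sn0 h1 h2 h3; exists T.
Qed.

End Maximizers.

(** * Degenerate cases and conclusion *)

Lemma maximizer_of_zero (R : realType) (d : nat) (p : R)
    (Delta : set (double_phase R d)) (S T : L2 R d -> L2 R d) :
  (forall T', hilbert_schmidt T' -> concentration p Delta S T' = 0%E) ->
  hilbert_schmidt T -> T <> (fun=> 0) -> maximizer p Delta S T.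
Proof.
move=> c0 hT Tn0; split; [exact: hT|exact: Tn0|].
rewrite (c0 T hT); apply/eqP; rewrite eq_le; apply/andP; split.
  by apply: ereal_sup_ubound; exists T; [split|exact: c0].
by apply: ge_ereal_sup => _ [T' [hT' _] <-]; rewrite c0.
Qed.

Lemma maximizer_zero (R : realType) (d : nat) (p : R) (Delta : set (double_phase R d)) :
  orthonormal_basis (@L2_basis R d) -> 1 <= p -> measurable Delta ->
  (lebesgue4 R d Delta < +oo)%E ->
  hilbert_schmidt (fun=> 0 : L2 R d) -> exists T, maximizer p Delta (fun=> 0) T.
Proof.
move=> e_basis p1 mDelta Delta_fin h0.
have p0 : 0 < p by exact: lt_le_trans p1.
(* The projection onto the line of e_0 is a convenient nonzero Hilbert-Schmidt operator. *)
have [T [hT Te]] := HS_exists e_basis (ell2_single 0 (L2_basis R d 0)).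
have [bT _] := (hilbert_schmidtP T).1 hT.
exists T; apply: maximizer_of_zero => [T' hT'||].
- have := energy_le e_basis p1 mDelta h0 hT'.
  rewrite (HS_norm0 e_basis) mul0r powR0 ?gt_eqF// mul0e => E0.
  have EE : energy p Delta (fun=> 0) T' = 0%E.
    by apply/eqP; rewrite eq_le E0; exact: energy_ge0.
  rewrite (concentrationE e_basis p1 mDelta Delta_fin h0 hT') EE.
  by rewrite powR0 ?mul0r// gt_eqF// invr_gt0.
- exact: hT.
- move=> T0; have := adjointP e_basis bT (L2_basis R d 0) (L2_basis R d 0).
  rewrite Te eqxx e_basis.1 T0 L2_dot0l => /eqP.
  by rewrite eq_sym oner_eq0.
Qed.

Theorem corollary6p9 (R : realType) (d : nat) (hd : (0 < d)%N)
    (p : R) (hp : 1 <= p)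
    (Delta : set (double_phase R d)) (mDelta : measurable Delta)
    (Delta_gt0 : (0 < lebesgue4 R d Delta)%E)
    (Delta_fin : (lebesgue4 R d Delta < +oo)%E)
    (S : L2 R d -> L2 R d) (hS : hilbert_schmidt S) :
  (exists T, maximizer p Delta S T) /\
  (S <> (fun=> 0) ->
   forall T_ : nat -> (L2 R d -> L2 R d),
     (forall n, hilbert_schmidt (T_ n)) ->
     (forall n, HS_norm (T_ n) = 1) ->
     concentration p Delta S (T_ n) @[n --> \oo] -->
       max_concentration p Delta S ->
     exists (phi : nat -> nat) (T : L2 R d -> L2 R d),
       [/\ {homo phi : m n / (m < n)%N},
           maximizer p Delta S T &
           HS_norm (T_ (phi n) \- T) @[n --> \oo] --> (0 : R)]).
Proof.
(* Without any orthonormal basis, [L2_basis] would be the default value 0 and all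
   Hilbert-Schmidt norms would vanish, so that any nonzero operator is a maximizer
   and there is no normalized sequence: no separability argument is needed. *)
have [e_basis|e0] : orthonormal_basis (@L2_basis R d) \/ @L2_basis R d = (fun=> 0).
  by rewrite /L2_basis; case: xgetP => [e -> /=|]; [left|right].
- split=> [|Sn0 T_ hT_ T_1 T_max].
    have [S0|Sn0] := pselect (S = (fun=> 0)); last exact: maximizer_exists.
    by rewrite S0 in hS *; exact: maximizer_zero.
  exact: maximizing_subsequence.
- have n0 T := HS_norm_no_basis T e0.
  split=> [|_ T_ _ /(_ 0%N)]; last by rewrite n0 => /eqP; rewrite eq_sym oner_eq0.
  have [f fn0] := L2_nontrivial R d.
  (* With a zero basis the identity satisfies the Hilbert-Schmidt condition, and all quotients
     vanish because the inverse of 0 is 0. *)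
  exists id; apply: maximizer_of_zero => [T' _||id0].
  + by rewrite /concentration n0 invr0 mule0.
  + split; [by []|by exists 1 => g; rewrite mul1r|].
    by rewrite eseries0// => k _ _; rewrite e0 L2_norm0 expr0n.
  + by apply: fn0; rewrite -[f]/(id f) id0.
Qed.
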